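(* Assume either Assumption A or Assumption B below. Let $(\mathbf g_n)$ be the (non-averaged) PSGD iterates with step sizes $\gamma_n=\gamma_1/n^b$, where $\gamma_1>0$ and $b\in(1/2,1)$. Then $$\mathbb{E}\big[\|\mathbf g_n-\mathbf g^*\|_v^2\big]=\mathcal O(1/n^b).$$
   Context: Setting: $\mu$ absolutely continuous probability on $\mathbb{R}^d$ with density $f_\mu$; $\nu=\sum_{i=1}^Mw_i\delta_{y_i}$, distinct $y_i$, $w_i>0$, $\sum w_i=1$, $w_{\min}=\min w_i$; cost $c\ge0$. $\mathbf g^c(x)=\min_i\{c(x,y_i)-g_i\}$; $\mathbb L_j(\mathbf g)=\{x:\mathbf g^c(x)=c(x,y_j)-g_j\}$; $h(\mathbf g,x)=-\mathbf g^c(x)-\sum_jw_jg_j$; $H(\mathbf g)=\mathbb{E}_{X\sim\mu}h(\mathbf g,X)$; $\mathbf g^*$ a minimizer of $H$; $\|\mathbf g\|_v=\|P\mathbf g\|$ with $P$ the orthogonal projection onto $\mathbf 1^\perp$. PSGD: fix a compact $K$ with $\mu(K)\ge1-\frac12w_{\min}$, $\|c\|_{K,\infty}=\sup_{x\in K,j}|c(x,y_j)|$, $\mathcal C=\{\mathbf g:|g_j|\le\|c\|_{K,\infty}\ \forall j\}$; with i.i.d. $X_1,X_2,\dots\sim\mu$, $\mathbf g_0\in\mathcal C$ and $\mathbf g_k=\mathrm{Proj}_{\mathcal C}(\mathbf g_{k-1}-\gamma_k\partial_{\mathbf g}h(\mathbf g_{k-1},X_k))$, $\partial_{\mathbf g}h(\mathbf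 g,x)_j=\mathbf 1_{x\in\mathbb L_j(\mathbf g)}-w_j$. (PW): $\rho$ satisfies it if $\exists C_{pw}$ with $\|f-\mathbb{E}_\rho f\|_{L^1(\rho)}\le C_{pw}\|\nabla f\|_{L^1(\rho)}$ for all $f\in C^1(\mathbb{R}^d)$. Assumption A: $\mathrm{Supp}\mu$ bounded; $\mu$ satisfies (PW); $c(\cdot,y_i)\in C^2(\mathrm{Supp}\mu)$; $\nabla_xc(x,y_i)\ne\nabla_xc(x,y_k)$ for $x\in\mathrm{Supp}\mu$, $i\ne k$; for each $i$ there are a convex $X_i$ and a $C^2$ diffeomorphism $\exp_i^c:X_i\to\mathrm{Supp}\mu$ with $\{p\in X_i:c(\exp_i^c(p),y_i)-c(\exp_i^c(p),y_k)\le t\}$ convex for all $t,k$; $(\exp_i^c)^{-1}(\mathrm{Supp}\mu)$ convex for all $i$. Assumption B: (B1) $c(x,y)=\frac12\|x-y\|^2$, $\mu$ with finite second moment; (B2) a compact $K'$ with $\mu(K')\ge1-\frac14w_{\min}$ such that the measure with density $f_\mu\mathbf 1_{K'}/\mu(K')$ satisfies (PW); (B3) with $f_\mu^{R+0}=f_\mu\mathbf 1_{\{\|x\|\le R\}}$, $f_\mu^{R+r}=f_\mu\mathbf 1_{\{R+r-2\le\|x\|\le R+r\}}$ ($r\ge1$), $C_{f_\mu}^{R+r}=\sup f_\mu^{R+r}$, $\omega_{f_\mu}^{R+r}$ its modulus of continuity: there exist $R>1$, $C>0$, a modulus $\omega$ with $\sum_{r\ge0}(R+r)^{d-1}\omega_{f_\mu}^{R+r}(\delta)\le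 C\omega(\delta)$ $\forall\delta>0$ and $\sum_{r\ge0}(R+r)^{d-1}C_{f_\mu}^{R+r}<\infty$. *)

(* Defs.v *)
From mathcomp Require Import all_boot all_order all_algebra.
From mathcomp Require Import all_classical all_reals all_analysis.
Import Order.TTheory GRing.Theory Num.Theory.
Import numFieldNormedType.Exports.

Set Implicit Arguments.
Unset Strict Implicit.
Unset Printing Implicit Defensive.

Local Open Scope ring_scope.
Local Open Scope classical_set_scope.

Definition Rd (R : realType) (d : nat) :=
  g_sigma_algebraType (@open (matrix R 1 d)).

(* Euclidean norm on R^d (the library norm on matrices is the max-norm). *)
Definition enorm (R : realType) (d : nat) (x : 'rV[R]_d) : R :=
  Num.sqrt (\sum_(i < d) x 0 i ^+ 2).

Definition evec (R : realType) (d : nat) (i : 'I_d) : 'rV[R]_d := delta_mx 0 i.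

Definition partial (R : realType) (d : nat) (i : 'I_d)
  (f : 'rV[R]_d -> R) (x : 'rV[R]_d) : R := 'D_(evec R i) f x.

Definition grad (R : realType) (d : nat) (f : 'rV[R]_d -> R) (x : 'rV[R]_d)
  : 'rV[R]_d := \row_i partial i f x.

Definition C1 (R : realType) (d : nat) (f : 'rV[R]_d -> R) : Prop :=
  forall i : 'I_d, (forall x, derivable f x (evec R i)) /\ continuous (partial i f).

Definition C2_on (R : realType) (d : nat) (U : set 'rV[R]_d)
  (f : 'rV[R]_d -> R) : Prop :=
  open U /\
  forall i : 'I_d,
    (forall x, U x -> derivable f x (evec R i)) /\
    (forall x, U x -> {for x, continuous (partial i f)}) /\
    forall j : 'I_d,
      (forall x, U x -> derivable (partial i f) x (evec R j)) /\
      (forall x, U x -> {for x, continuous (partial j (partial i f))}).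

Definition C2_set (R : realType) (d : nat) (S : set 'rV[R]_d)
  (f : 'rV[R]_d -> R) : Prop :=
  exists U : set 'rV[R]_d, S `<=` U /\ C2_on U f.

Definition C2_map_set (R : realType) (d : nat) (S : set 'rV[R]_d)
  (phi : 'rV[R]_d -> 'rV[R]_d) : Prop :=
  forall k : 'I_d, C2_set S (fun p => phi p 0 k).

Definition C2_diffeo (R : realType) (d : nat) (X Y : set 'rV[R]_d)
  (phi : 'rV[R]_d -> 'rV[R]_d) : Prop :=
  exists psi : 'rV[R]_d -> 'rV[R]_d,
    [/\ (forall p, X p -> Y (phi p)),
        (forall x, Y x -> X (psi x)),
        (forall p, X p -> psi (phi p) = p),
        (forall x, Y x -> phi (psi x) = x) &
        C2_map_set X phi /\ C2_map_set Y psi].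

Definition is_convex_set (R : realType) (d : nat) (S : set 'rV[R]_d) : Prop :=
  forall a b : 'rV[R]_d, S a -> S b ->
    forall t : R, 0 <= t <= 1 -> S ((1 - t) *: a + t *: b).

(* lam is the Lebesgue measure on the Borel sets of R^d: it gives to
   every closed box its volume (this determines it uniquely). *)
Definition is_lebesgue (R : realType) (d : nat)
  (lam : {measure set (Rd R d) -> \bar R}) : Prop :=
  forall a b : 'rV[R]_d, (forall i, a 0 i <= b 0 i) ->
    lam [set x : 'rV[R]_d | forall i, a 0 i <= x 0 i <= b 0 i] =
    (\prod_(i < d) (b 0 i - a 0 i))%:E.

Definition is_density (R : realType) (d : nat)
  (lam : {measure set (Rd R d) -> \bar R}) (mu : probability (Rd R d) R)
  (f : 'rV[R]_d -> R) : Prop :=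
  (forall x, 0 <= f x) /\
  measurable_fun [set: Rd R d] (f : Rd R d -> R) /\
  forall A : set (Rd R d), measurable A ->
    mu A = (\int[lam]_(x in A) (f x)%:E)%E.

Definition supp (R : realType) (d : nat) (mu : {measure set (Rd R d) -> \bar R})
  : set 'rV[R]_d :=
  [set x : 'rV[R]_d | forall e : R, 0 < e -> (0 < mu (ball x e))%E].

Definition PW (R : realType) (d : nat) (rho : {measure set (Rd R d) -> \bar R})
  : Prop :=
  exists Cpw : R, forall f : 'rV[R]_d -> R, C1 f ->
    (\int[rho]_x (`| f x - fine (\int[rho]_z (f z)%:E) |)%:E
      <= Cpw%:E * \int[rho]_x (enorm (grad f x))%:E)%E.

(* minimum over a finite index set (the seed is one of the terms when
   M > 0) *)
Definition minI (R : realType) (M : nat) (F : 'I_M -> R) : R :=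
  \big[Num.min/head 0 [seq F i | i <- enum 'I_M]]_(i < M) F i.

Definition wmin (R : realType) (M : nat) (w : 'I_M -> R) : R := minI w.

Definition ctrans (R : realType) (d M : nat) (c : 'rV[R]_d -> 'rV[R]_d -> R)
  (y : 'I_M -> 'rV[R]_d) (g : 'I_M -> R) (x : 'rV[R]_d) : R :=
  minI (fun i => c x (y i) - g i).

Definition Lcell (R : realType) (d M : nat) (c : 'rV[R]_d -> 'rV[R]_d -> R)
  (y : 'I_M -> 'rV[R]_d) (g : 'I_M -> R) (j : 'I_M) : set 'rV[R]_d :=
  [set x | ctrans c y g x = c x (y j) - g j].

Definition hfun (R : realType) (d M : nat) (c : 'rV[R]_d -> 'rV[R]_d -> R)
  (y : 'I_M -> 'rV[R]_d) (w : 'I_M -> R) (g : 'I_M -> R) (x : 'rV[R]_d) : R :=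
  - ctrans c y g x - \sum_(j < M) w j * g j.

Definition Hfun (R : realType) (d M : nat) (c : 'rV[R]_d -> 'rV[R]_d -> R)
  (y : 'I_M -> 'rV[R]_d) (w : 'I_M -> R) (mu : probability (Rd R d) R)
  (g : 'I_M -> R) : \bar R :=
  (\int[mu]_x (hfun c y w g x)%:E)%E.

(* stochastic gradient  (d_g h(g,x))_j = 1_{x in L_j(g)} - w_j *)
Definition sgrad (R : realType) (d M : nat) (c : 'rV[R]_d -> 'rV[R]_d -> R)
  (y : 'I_M -> 'rV[R]_d) (w : 'I_M -> R) (g : 'I_M -> R) (x : 'rV[R]_d)
  (j : 'I_M) : R :=
  \1_(Lcell c y g j) x - w j.

(* squared seminorm ||g||_v^2 = ||P g||^2, P = orthogonal projection onto 1^perp *)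
Definition vnorm2 (R : realType) (M : nat) (g : 'I_M -> R) : R :=
  \sum_(j < M) (g j - (\sum_(i < M) g i) / M%:R) ^+ 2.

Definition csupK (R : realType) (d M : nat) (c : 'rV[R]_d -> 'rV[R]_d -> R)
  (y : 'I_M -> 'rV[R]_d) (K : set 'rV[R]_d) : R :=
  sup [set r : R | exists x j, K x /\ r = `| c x (y j) |].

Definition clamp (R : realType) (a t : R) : R := Num.max (- a) (Num.min a t).

Definition step (R : realType) (gamma1 b : R) (n : nat) : R :=
  gamma1 / (n%:R `^ b).

(* PSGD iterates.  The sample used at step k+1 is X k (i.e. the paper's
   X_{k+1} is X k here). *)
Fixpoint psgd (R : realType) (d M : nat) (c : 'rV[R]_d -> 'rV[R]_d -> R)
  (y : 'I_M -> 'rV[R]_d) (w : 'I_M -> R) (K : set 'rV[R]_d)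
  (gamma1 b : R) (g0 : 'I_M -> R) (T : Type) (X : nat -> T -> 'rV[R]_d)
  (n : nat) (om : T) : 'I_M -> R :=
  match n with
  | 0 => g0
  | k.+1 =>
      let gk := psgd c y w K gamma1 b g0 X k om in
      fun j => clamp (csupK c y K)
                 (gk j - step gamma1 b k.+1 * sgrad c y w gk (X k om) j)
  end.

Definition iid_law (R : realType) (d : nat) (d0 : measure_display)
  (Omega : measurableType d0) (P : probability Omega R)
  (X : nat -> Omega -> 'rV[R]_d) (mu : probability (Rd R d) R) : Prop :=
  (forall k, measurable_fun [set: Omega] (X k : Omega -> Rd R d)) /\
  (forall k (A : set (Rd R d)), measurable A -> P (X k @^-1` A) = mu A) /\
  (forall (s : seq nat) (A : nat -> set (Rd R d)), uniq s ->
     (forall k, measurable (A k)) ->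
     P (\bigcap_(k in [set k | k \in s]) (X k @^-1` A k)) =
     (\prod_(k <- s) P (X k @^-1` A k))%E).

Definition assumptionA (R : realType) (d M : nat)
  (c : 'rV[R]_d -> 'rV[R]_d -> R) (y : 'I_M -> 'rV[R]_d)
  (mu : probability (Rd R d) R) : Prop :=
  [/\ (exists r : R, forall x, supp mu x -> enorm x <= r),
      PW mu,
      (forall i, C2_set (supp mu) (fun x => c x (y i))),
      (forall x, supp mu x -> forall i k : 'I_M, i != k ->
          grad (fun z => c z (y i)) x != grad (fun z => c z (y k)) x) &
      (forall i : 'I_M, exists (Xi : set 'rV[R]_d) (phi : 'rV[R]_d -> 'rV[R]_d),
         [/\ is_convex_set Xi,
             C2_diffeo Xi (supp mu) phi,
             (forall (t : R) (k : 'I_M),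
                is_convex_set [set p | Xi p /\
                  c (phi p) (y i) - c (phi p) (y k) <= t]) &
             is_convex_set [set p | Xi p /\ supp mu (phi p)]])].

Definition fpiece (R : realType) (d : nat) (f : 'rV[R]_d -> R) (R0 : R)
  (r : nat) (x : 'rV[R]_d) : R :=
  if r == 0%N then f x * \1_([set z | enorm z <= R0]) x
  else f x * \1_([set z | R0 + r%:R - 2 <= enorm z <= R0 + r%:R]) x.

Definition esupf (R : realType) (d : nat) (f : 'rV[R]_d -> R) : \bar R :=
  ereal_sup [set (f x)%:E | x in [set: 'rV[R]_d]].

Definition cmodulus (R : realType) (d : nat) (f : 'rV[R]_d -> R) (delta : R)
  : \bar R :=
  ereal_sup [set e | exists x x' : 'rV[R]_d,
                       enorm (x - x') <= delta /\ e = (`| f x - f x' |)%:E].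

Definition is_modulus (R : realType) (om : R -> R) : Prop :=
  [/\ (forall t, 0 <= t -> 0 <= om t),
      (forall s t, 0 <= s -> s <= t -> om s <= om t) &
      om t @[t --> 0^'+] --> 0].

Definition assumptionB (R : realType) (d M : nat)
  (c : 'rV[R]_d -> 'rV[R]_d -> R) (w : 'I_M -> R)
  (mu : probability (Rd R d) R) (f : 'rV[R]_d -> R) : Prop :=
  [/\
      (forall x z, c x z = (enorm (x - z)) ^+ 2 / 2) /\
      (\int[mu]_x ((enorm x) ^+ 2)%:E < +oo)%E,
      (exists (K' : set (Rd R d)) (mK' : measurable K'),
         [/\ compact (K' : set 'rV[R]_d),
             (mu K' >= (1 - wmin w / 4)%:E)%E &
             PW (mnormalize (mrestr mu mK') mu)]) &
      (exists (R0 C : R) (om : R -> R),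
         [/\ 1 < R0, 0 < C, is_modulus om,
             (forall delta : R, 0 < delta ->
                (\sum_(0 <= r <oo)
                    ((R0 + r%:R) ^+ d.-1)%:E * cmodulus (fpiece f R0 r) delta
                  <= (C * om delta)%:E)%E) &
             (\sum_(0 <= r <oo)
                 ((R0 + r%:R) ^+ d.-1)%:E * esupf (fpiece f R0 r) < +oo)%E])].

(* Main.v *)
(* The semi-discrete dual is strongly monotone around [g*], without any second derivative of [H].
   With [v = g - g*], a joint tally of the cells of [g] and [g*] writes [<grad H(g), v>] as a sum
   of [mu (L_l(g) & L_j(g* )) * (v_l - v_j)] with nonnegative terms.  Cut the indices into [S] and
   its complement at a gap [delta >= osc(v) / M] of the values of [v]: the points that move from a
   cell outside [S] to a cell in [S] form a slab around the interface of the two groups of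
   cells, and the Poincare-Wirtinger inequality, applied to a [C^1] function that goes from [1] to
   [0] across the slab with gradient [O(1 / delta)], gives it mass at least of order [delta].  Hence
   [<grad H(g), v>] is at least of order [delta ^ 2].
   Ties between cells are null because the level sets of [c(., y_i) - c(., y_k)] are [C^1] graphs.
   The Lyapunov function is the squared distance to the set of minimizers in the box.  The iterates
   take finitely many values, so independence turns its expectation into finite sums, which
   satisfy [e_(n+1) <= (1 - a / n^b) e_n + C / n^(2 b)]. *)
Require Import Defs.
From mathcomp Require Import all_boot all_order all_algebra.
From mathcomp Require finmap.
From mathcomp Require Import all_classical all_reals all_analysis.
From mathcomp Require Import measurable_realfun ring lra.
Import Order.TTheory GRing.Theory Num.Theory.
Import numFieldNormedType.Exports.
Local Open Scope ring_scope.
Local Open Scope classical_set_scope.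

Set Implicit Arguments.
Unset Strict Implicit.
Unset Printing Implicit Defensive.

(** * Functions with continuous partial derivatives *)

(** The quadratic lower bound is needed on the whole box that the iterates visit, and there a cell
    of [g] may well be empty: only the cells of [gs] have a known mass. The test function is
    therefore built from the cells of [gs] alone, at scale [delta], and its zero region is handled
    by a dichotomy: either the slab already has a fixed mass, or a cell of [gs] outside [S] keeps a
    fixed mass once the slab is removed. In the second case the inequality reads: a constant is at
    most [const / delta] times the mass of the slab.

    Both assumptions are reduced to one measure [rho], bounded by a multiple of [mu] and missing at
    most [wmin w / 4] of its mass: [mu] itself, or its normalized restriction to a compact set.

    Adding a constant to [g] does not change [H], so minimizers come in lines [gs + t]. The clamp
    does not respect these lines, which is why the distance is taken to the part of the line inside
    the box. *)

Definition C1_with (R : realType) (d : nat) (U : set 'rV[R]_d)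
    (f : 'rV[R]_d -> R) (df : 'I_d -> 'rV[R]_d -> R) : Prop :=
  open U /\ forall i x, U x ->
    is_derive x (evec R i) f (df i x) /\ {for x, continuous (df i)}.

Lemma C2_set_C1_with (R : realType) (d : nat) (S : set 'rV[R]_d) (f : 'rV[R]_d -> R) :
  C2_set S f ->
  exists2 U : set 'rV[R]_d, S `<=` U & C1_with U f (fun i => partial i f).
Proof.
move=> [U [SU [oU H]]]; exists U => //; split=> // i x Ux.
have [h1 [h2 _]] := H i; split; last exact: h2.
exact/derivableP/h1.
Qed.

Lemma C1_with_C1 (R : realType) (d : nat) (f : 'rV[R]_d -> R) df :
  C1_with setT f df -> C1 f /\ forall i x, partial i f x = df i x.
Proof.
move=> [_ H].
have E i : partial i f = df i.
  by apply/funext => x; have [h _] := H i x I; rewrite /partial derive_val.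
split; last by move=> i x; rewrite E.
move=> i; split=> [x|]; first by have [h _] := H i x I; exact: ex_derive.
by rewrite E => x; have [_ h] := H i x I; exact: h.
Qed.

Lemma C1_with_open (R : realType) (d : nat) (U V : set 'rV[R]_d) f df :
  open V -> V `<=` U -> C1_with U f df -> C1_with V f df.
Proof. by move=> oV VU [_ H]; split=> // i x /VU; exact: H. Qed.

(** Carries directional derivatives to one real variable, where the mean value theorem and the chain
    rule apply. *)
Lemma is_derive_line (R : realType) (V : normedModType R) (f : V -> R) (x v : V) t (a : R) :
  is_derive t (1:R) (fun h : R => f (x + h *: v)) a <-> is_derive (x + t *: v) v f a.
Proof.
have E : (fun h : R => h^-1 *: (f (x + (h *: (1:R) + t) *: v) - f (x + t *: v))) =
         (fun h : R => h^-1 *: (f (h *: v + (x + t *: v)) - f (x + t *: v))).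
  apply/funext => h; congr (_ *: (f _ - _)).
  rewrite (_ : h *: (1:R) = h); last by rewrite /GRing.scale/= mulr1.
  rewrite scalerDl.
  by rewrite addrCA addrA.
split=> -[H1 H2]; split.
- by move: H1; rewrite /derivable /= E.
- by move: H2; rewrite /derive /= E.
- by move: H1; rewrite /derivable /= E.
- by move: H2; rewrite /derive /= E.
Qed.

Lemma MVT_between (R : realType) (f df : R -> R) (a b : R) :
  (forall x, Num.min a b <= x <= Num.max a b -> is_derive x 1 f (df x)) ->
  exists2 c, Num.min a b <= c <= Num.max a b & f b - f a = df c * (b - a).
Proof.
wlog ab : a b / a <= b => [W|] H.
  case/orP: (le_total a b) => [/W|/W]; first exact.
  rewrite minC maxC => /(_ H)[c hc E]; exists c => //.
  by rewrite -opprB E; ring.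
move: H; rewrite (min_idPl ab) (max_idPr ab) => H.
have [x|x|c hc E] := @MVT_segment R f df a b ab.
- by rewrite in_itv/= => /andP[/ltW xa /ltW xb]; apply: H; rewrite xa.
- apply: derivable_within_continuous => y; rewrite in_itv/= => yab.
  by have h := H _ yab; exact: ex_derive.
by exists c => //; move: hc; rewrite in_itv.
Qed.

Lemma rV_ball (R : realType) (d : nat) (x y : 'rV[R]_d) (e : R) :
  ball x e y <-> 0 < e /\ forall i, `|x 0 i - y 0 i| < e.
Proof.
split=> -[e0 h]; split=> //; first by move=> i; exact: h.
by move=> i j; rewrite ord1; exact: h.
Qed.

(* Telescoping over the coordinates keeps all the intermediate points inside the
   sup-norm ball, which is a box. *)
Lemma box_mean_value (R : realType) (d : nat) (U : set 'rV[R]_d) f df p r (x x' : 'rV[R]_d) :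
  C1_with U f df -> ball p r `<=` U -> ball p r x -> ball p r x' ->
  exists xi : 'I_d -> 'rV[R]_d, (forall i, ball p r (xi i)) /\
    f x' - f x = \sum_(i < d) df i (xi i) * (x' 0 i - x 0 i).
Proof.
move=> [oU HU] bU /rV_ball[r0 bx] /rV_ball[_ bx'].
pose z k : 'rV[R]_d := \row_(i < d) (if (i < k)%N then x' 0 i else x 0 i).
have step (i : 'I_d) : exists xi, ball p r xi /\
    f (z i.+1) - f (z i) = df i xi * (x' 0 i - x 0 i).
  pose L (h : R) := z i + (h - x 0 i) *: evec R i.
  have Lb (h : R) : Num.min (x 0 i) (x' 0 i) <= h <= Num.max (x 0 i) (x' 0 i) ->
      ball p r (L h).
    move=> hh; apply/rV_ball; split=> // j; rewrite /L !mxE eqxx /= .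
    case: (eqVneq j i) => [->|ji] /=; last first.
      by rewrite mulr0 addr0; case: ifP => _; [exact: bx'|exact: bx].
    rewrite ltnn mulr1 addrC subrK.
    move: (bx i) (bx' i) hh; rewrite !ltr_norml => /andP[? ?] /andP[? ?].
    by case: (leP (x 0 i) (x' 0 i)) => ? /andP[? ?]; apply/andP; split; lra.
  have [|c hc E] := @MVT_between R (fun h => f (L h)) (fun h => df i (L h)) (x 0 i) (x' 0 i).
    move=> h hh; have [H1 _] := HU i (L h) (bU _ (Lb h hh)).
    have e1 : L h = (z i - x 0 i *: evec R i) + h *: evec R i.
      by rewrite /L scalerBl addrA addrAC.
    have e2 : (fun h => f (L h)) = (fun h => f ((z i - x 0 i *: evec R i) + h *: evec R i)).
      by apply/funext => t; rewrite /L scalerBl addrA addrAC.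
    by rewrite e2; apply/is_derive_line; rewrite -e1.
  exists (L c); split; first exact: Lb.
  rewrite -E; congr (f _ - f _).
    apply/rowP => j; rewrite /L !mxE eqxx/=.
    case: (eqVneq j i) => [->|ji] /=; first by rewrite ltnS leqnn ltnn mulr1; ring.
    by rewrite mulr0 addr0 ltnS leq_eqVlt (inj_eq val_inj) (negbTE ji).
  by rewrite /L subrr scale0r addr0.
have [xi Hxi] := choice step; exists xi; split; first by move=> i; exact: (Hxi i).1.
transitivity (\sum_(i < d) (f (z i.+1) - f (z i))); last first.
  by apply: eq_bigr => i _; exact: (Hxi i).2.
rewrite -(big_mkord xpredT (fun i => f (z i.+1) - f (z i))) telescope_sumr//.
congr (f _ - f _); apply/rowP => j; rewrite mxE ?ltn_ord//.
Qed.

Lemma C1_with_locally_bounded (R : realType) (d : nat) (U : set 'rV[R]_d) f df x :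
  C1_with U f df -> U x ->
  exists e B : R, [/\ 0 < e, 0 <= B, ball x e `<=` U &
    forall i y, ball x e y -> `|df i y| <= B].
Proof.
move=> [oU HU] Ux.
pose B := \sum_i (`|df i x| + 1).
have h : \forall y \near x, U y /\ forall i, `|df i y| <= B.
  near=> y; split; first by near: y; exact: open_nbhs_nbhs.
  move=> i; apply: (@le_trans _ _ (`|df i x| + 1)); last first.
    by rewrite /B (bigD1 i)//= lerDl sumr_ge0// => j _; rewrite addr_ge0.
  move: i; near: y; apply: filter_forall => i.
  have [_ /cvgr_dist_lt /(_ 1 ltr01)] := HU i x Ux.
  apply: filterS => y; rewrite distrC => hy.
  have := ler_normD (df i x) (df i y - df i x).
  rewrite addrC subrK => hh; rewrite (le_trans hh)// lerD2l; exact: ltW.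
have /nbhs_ballP[e /= e0 He] := h.
exists e, B; split=> //.
- by rewrite /B sumr_ge0// => j _; rewrite addr_ge0.
- by move=> y /He[].
- by move=> i y /He[_]; exact.
Unshelve. all: by end_near. Qed.

(** [C1_with] speaks only of partial derivatives; being locally bounded, they make [f] locally
    Lipschitz. *)
Lemma C1_with_continuous (R : realType) (d : nat) (U : set 'rV[R]_d) f df x :
  C1_with U f df -> U x -> {for x, continuous f}.
Proof.
move=> hf Ux; have [e [B [e0 B0 eU hB]]] := C1_with_locally_bounded hf Ux.
apply/(@cvgrPdist_lt _ _ _ (nbhs x) (nbhs_filter x)) => eps eps0.
pose r := Num.min e (eps / (d%:R * B + 1)).
have dB0 : 0 < d%:R * B + 1 by rewrite ltr_wpDl// mulr_ge0.
have r0 : 0 < r by rewrite /r lt_min e0 divr_gt0.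
apply/nbhs_ballP; exists r => //= y hy.
have hy' : ball x e y by apply: le_ball hy; rewrite /r ge_min lexx.
have [xi [h1 ->]] := box_mean_value hf eU hy' (ballxx x e0).
apply: le_lt_trans (ler_norm_sum _ _ _) _.
have /rV_ball[_ hy2] := hy.
apply: (@le_lt_trans _ _ (\sum_(i < d) B * r)).
  apply: ler_sum => i _; rewrite normrM ler_pM//; first exact: hB.
  exact/ltW/hy2.
rewrite sumr_const card_ord -mulr_natl mulrA.
have : (d%:R * B + 1) * r <= eps.
  by rewrite mulrC -ler_pdivlMr// /r ge_min lexx orbT.
by rewrite mulrDl mul1r => ?; lra.
Qed.

(* Composing [possq] with sums builds [C^1] cutoffs without any product or maximum:
   [possq (1 - \sum_k possq (u k))] is [1] if all [u k <= 0] and [0] if some [u k >= 1]. *)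
Definition possq (R : realType) (t : R) : R := Num.max t 0 ^+ 2.

Lemma possq_ge0 (R : realType) (t : R) : 0 <= possq t.
Proof. exact: sqr_ge0. Qed.

Lemma possq1 (R : realType) : possq (1 : R) = 1.
Proof. by rewrite /possq max_l ?expr1n. Qed.

Lemma possq_le0 (R : realType) (t : R) : t <= 0 -> possq t = 0.
Proof. by move=> t0; rewrite /possq max_r// expr0n. Qed.

Lemma possq_ge1 (R : realType) (t : R) : 1 <= t -> 1 <= possq t.
Proof.
move=> t1; rewrite /possq max_l; last exact: le_trans t1.
by rewrite expr_ge1// (le_trans _ t1).
Qed.

Lemma is_derive_possq (R : realType) (t : R) :
  is_derive t (1:R) (@possq R) (2 * Num.max t 0).
Proof.
have [t0|t0|->] := ltgtP t 0.
- apply: (@near_eq_is_derive R R R (cst 0)).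
    near=> x; rewrite /= /possq max_r ?expr0n//.
    by apply: ltW; near: x; exact: lt_nbhsl.
  by rewrite mulr0; exact: is_derive_cst.
- apply: (@near_eq_is_derive R R R (fun x => x ^+ 2)).
    near=> x; rewrite /= /possq max_l//.
    by apply: ltW; near: x; exact: lt_nbhsr.
  apply: is_derive_eq; rewrite (_ : t%:A = t) ?[X in X = _]/=; last by rewrite /GRing.scale/= mulr1.
  by rewrite -mulr2n mulr_natl.
(* At the kink the difference quotient of [possq] is [Num.max x 0] itself, which is continuous. *)
- apply/is_derive1_caratheodory; exists (fun x => Num.max x 0); split.
  + move=> z; rewrite subr0 /possq [Num.max 0 0]max_l// expr0n/= subr0.
    have [z0|z0] := leP z 0; first by rewrite expr0n/= mul0r.
    by rewrite expr2.
  + apply: (@continuous_max _ _ id (cst 0)); first exact: cvg_id.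
    exact: cst_continuous.
  + by rewrite max_l// mulr0.
Unshelve. all: by end_near. Qed.

Section C1_closure.
Variables (R : realType) (d : nat) (U : set 'rV[R]_d).
Implicit Types (f g : 'rV[R]_d -> R).

Lemma C1_with_cst (a : R) : open U -> C1_with U (cst a) (fun _ => cst 0).
Proof.
move=> oU; split=> // i x Ux; split; first exact: is_derive_cst.
exact: cst_continuous.
Qed.

Lemma C1_withD f df g dg : C1_with U f df -> C1_with U g dg ->
  C1_with U (fun x => f x + g x) (fun i x => df i x + dg i x).
Proof.
move=> [oU F] [_ G]; split=> // i x Ux.
have [F1 F2] := F i x Ux; have [G1 G2] := G i x Ux; split; first exact: is_deriveD.
exact: (@continuousD _ _ _ (df i) (dg i)).
Qed.

Lemma C1_withM f df g dg : C1_with U f df -> C1_with U g dg ->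
  C1_with U (fun x => f x * g x) (fun i x => f x * dg i x + g x * df i x).
Proof.
move=> hf hg; have [oU F] := hf; have [_ G] := hg; split=> // i x Ux.
have [F1 F2] := F i x Ux; have [G1 G2] := G i x Ux; split; first exact: is_deriveM.
have cf := C1_with_continuous hf Ux; have cg := C1_with_continuous hg Ux.
apply: (@continuousD _ _ _ (fun x => f x * dg i x) (fun x => g x * df i x)).
  exact: (@continuousM _ _ f (dg i)).
exact: (@continuousM _ _ g (df i)).
Qed.

Lemma C1_withZ (a : R) f df : C1_with U f df ->
  C1_with U (fun x => a * f x) (fun i x => a * df i x).
Proof.
move=> [oU F]; split=> // i x Ux; have [F1 F2] := F i x Ux; split.
  exact: is_deriveZ.
by apply: (@continuousM _ _ (cst a) (df i)) => //; exact: cst_continuous.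
Qed.

Lemma C1_withB f df g dg : C1_with U f df -> C1_with U g dg ->
  C1_with U (fun x => f x - g x) (fun i x => df i x - dg i x).
Proof.
move=> [oU F] [_ G]; split=> // i x Ux.
have [F1 F2] := F i x Ux; have [G1 G2] := G i x Ux; split; first exact: is_deriveB.
exact: (@continuousB _ _ _ (df i) (dg i)).
Qed.

Lemma C1_with_sum (I : Type) (r : seq I) (P : pred I) (f : I -> 'rV[R]_d -> R) df :
  open U -> (forall k, P k -> C1_with U (f k) (df k)) ->
  C1_with U (fun x => \sum_(k <- r | P k) f k x) (fun i x => \sum_(k <- r | P k) df k i x).
Proof.
move=> oU H; elim: r => [|k r IH].
  have := C1_with_cst 0 oU; congr C1_with; first by apply/funext => x; rewrite big_nil.
  by apply/funext => i; apply/funext => x; rewrite big_nil.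
have [Pk|nPk] := boolP (P k); last first.
  move: IH; congr C1_with; first by apply/funext => x; rewrite big_cons (negbTE nPk).
  by apply/funext => i; apply/funext => x; rewrite big_cons (negbTE nPk).
have := C1_withD (H k Pk) IH; congr C1_with.
  by apply/funext => x; rewrite big_cons Pk.
by apply/funext => i; apply/funext => x; rewrite big_cons Pk.
Qed.

Lemma C1_with_possq f df : C1_with U f df ->
  C1_with U (fun x => possq (f x)) (fun i x => 2 * Num.max (f x) 0 * df i x).
Proof.
move=> hf; have [oU F] := hf; split=> // i x Ux; have [F1 F2] := F i x Ux; split.
  have e : x = x + 0 *: evec R i by rewrite scale0r addr0.
  rewrite {1}e; apply/is_derive_line.
  rewrite e in F1; move/is_derive_line in F1.
  have := @is_derive1_comp R (@possq R) (fun h => f (x + h *: evec R i)) 0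
    (2 * Num.max (f x) 0) (df i x) _ _.
  rewrite scale0r addr0 => h; apply: h; first exact: is_derive_possq.
  by move: F1; rewrite scale0r addr0.
apply: (@continuousM _ _ (fun x => 2 * Num.max (f x) 0) (df i)) => //.
apply: (@continuousM _ _ (cst 2) (fun x => Num.max (f x) 0)); first exact: cst_continuous.
apply: (@continuous_max _ _ f (cst 0)); first exact: C1_with_continuous hf Ux.
exact: cst_continuous.
Qed.

Lemma C1_with_coord (k : 'I_d) : open U ->
  C1_with U (fun x => x 0 k) (fun i => cst ((k == i)%:R)).
Proof.
move=> oU; split=> // i x _; split; last exact: cst_continuous.
have e : x = x + 0 *: evec R i by rewrite scale0r addr0.
rewrite e; apply/is_derive_line.
rewrite (_ : (fun h => _) = (fun h : R => x 0 k + (k == i)%:R * h)); last first.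
  by apply/funext => h; rewrite !mxE eqxx/= mulrC.
have := @is_deriveD R R R (cst (x 0 k)) (fun h => (k == i)%:R * h) 0 1 0 (k == i)%:R
  (is_derive_cst _ _ _) _.
rewrite add0r; apply.
by have := @is_deriveZ R R R id (k == i)%:R 0 1 1 (is_derive_id _ _); rewrite /GRing.scale/= mulr1.
Qed.

End C1_closure.

(** * Smooth cutoffs and extension of functions given near a compact set *)

Section bump.
Variables (R : realType) (d : nat).

(** The shift by [1] puts the transition of each coordinate between the distances [r] and [2 * r]
    from [p], one term for each side. *)
Definition box_bump (p : 'rV[R]_d) (r : R) (x : 'rV[R]_d) : R :=
  possq (1 - \sum_(k < d) (possq (r^-1 * (x 0 k - p 0 k) - 1) +
                           possq (r^-1 * (p 0 k - x 0 k) - 1))).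

Lemma C1_with_box_bump p r : exists db, C1_with setT (box_bump p r) db.
Proof.
eexists; apply: C1_with_possq; apply: C1_withB; first exact: (C1_with_cst (d := d) 1 openT).
apply: (@C1_with_sum R d setT _ _ xpredT); first exact: openT.
move=> k _; apply: C1_withD; apply: C1_with_possq; apply: C1_withB;
  try exact: (C1_with_cst (d := d) 1 openT);
  apply: C1_withZ; apply: C1_withB; try exact: (C1_with_coord k openT);
  exact: (C1_with_cst (d := d) (p 0 k) openT).
Qed.

Lemma box_bump_eq1 p r x : ball p r x -> box_bump p r x = 1.
Proof.
move=> /rV_ball[r0 h]; rewrite /box_bump big1 ?subr0 ?possq1// => k _.
have := h k; rewrite ltr_norml => /andP[h1 h2].
by rewrite !possq_le0 ?addr0// subr_le0 mulrC ler_pdivrMr// mul1r; lra.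
Qed.

Lemma box_bump_neq0 p r x : 0 < r -> box_bump p r x != 0 ->
  forall k, `|x 0 k - p 0 k| <= 2 * r.
Proof.
move=> r0; apply: contraNP => /existsNP[k /negP]; rewrite -ltNge => hk.
rewrite /box_bump possq_le0// subr_le0 (bigD1 k)//=.
have s0 : 0 <= \sum_(i < d | i != k) (possq (r^-1 * (x 0 i - p 0 i) - 1) +
                           possq (r^-1 * (p 0 i - x 0 i) - 1)).
  by apply: sumr_ge0 => i _; rewrite addr_ge0// possq_ge0.
have := possq_ge0 (r^-1 * (x 0 k - p 0 k) - 1).
have := possq_ge0 (r^-1 * (p 0 k - x 0 k) - 1).
have H (u : R) : 2 * r < u -> 1 <= possq (r^-1 * u - 1).
  move=> u2; apply: possq_ge1; rewrite lerBrDr -[1 + 1]/(2:R) mulrC ler_pdivlMr//; lra.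
move: hk; rewrite lter_normr; case/orP => /H; rewrite ?opprB; lra.
Qed.

End bump.

Section cutoff.
Import finmap.

(** Finitely many bumps cover [S]. The cutoff vanishes near each point outside [U], not just at it,
    so that its product with a function known only on [U] is differentiable there. *)
Lemma cutoff (R : realType) (d : nat) (S U : set 'rV[R]_d) :
  compact S -> open U -> S `<=` U ->
  exists chi dchi, [/\ C1_with setT chi dchi, (forall x, S x -> chi x = 1) &
    forall x, ~ U x -> \forall y \near x, chi y = 0].
Proof.
move=> cS oU SU.
have [r Hr] : {r : 'rV[R]_d -> R | forall p, S p -> 0 < r p /\ ball p (3 * r p) `<=` U}.
  suff /choice[r Hr] : forall p, exists r : R, S p -> 0 < r /\ ball p (3 * r) `<=` U.
    by exists r.
  move=> p; have [Sp|nSp] := pselect (S p); last by exists 0.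
  have /nbhs_ballP[e /= e0 He] := open_nbhs_nbhs (conj oU (SU p Sp)).
  (* A bump lives within distance [2 * r p] of [p]; the third [r p] leaves room for a neighbourhood
     of a point outside [U]. *)
  exists (e / 3) => _; split; first by rewrite divr_gt0.
  by rewrite mulrC divfK.
move: cS; rewrite compact_cover => /(_ _ S (fun p => ball p (r p))) [].
- by move=> p Sp; exact: ball_open.
- by move=> p Sp; exists p => //; apply: ballxx; exact: (Hr p Sp).1.
move=> D DS SD.
have /choice[db Hdb] p := C1_with_box_bump p (r p).
pose B x := \sum_(p <- D) box_bump p (r p) x.
(* The sum [B] of the bumps is at least [1] on [S]; the outer [possq] caps it at exactly [1]. *)
eexists (fun x => 1 - possq (1 - B x)), _; split.
- apply: C1_withB; first exact: (C1_with_cst (d := d) 1 openT).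
  apply: C1_with_possq; apply: C1_withB; first exact: (C1_with_cst (d := d) 1 openT).
  by apply: (@C1_with_sum R d setT _ _ xpredT); [exact: openT|move=> p _; exact: Hdb].
- move=> x /SD[p /= pD px]; rewrite possq_le0 ?subr0// subr_le0 /B.
  rewrite (big_rem p)//= box_bump_eq1// lerDl sumr_ge0// => q _; exact: possq_ge0.
- move=> x nUx.
  have : \forall y \near x, forall p, p \in D -> box_bump p (r p) y = 0.
    have := @filter_bigI _ _ D (fun p => [set y | box_bump p (r p) y = 0]) (nbhs x) (nbhs_filter x).
    move=> h; apply: filterS (h _) => [y hy p pD|p pD]; first exact: hy.
    have [rp0 rpU] : 0 < r p /\ ball p (3 * r p) `<=` U.
      by apply: Hr; exact: set_mem (DS p pD).
    apply/nbhs_ballP; exists (r p) => //= y /rV_ball[_ xy].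
    apply/eqP; apply: contra_notT nUx => /(box_bump_neq0 rp0) hb.
    apply: rpU; apply/rV_ball; split; first by rewrite mulr_gt0.
    move=> k; rewrite (_ : 3 * r p = 2 * r p + r p); last by ring.
    rewrite (_ : _ - _ = - (y 0 k - p 0 k) - (x 0 k - y 0 k)); last by ring.
    by apply: le_lt_trans (ler_normB _ _) _; rewrite normrN ler_ltD.
  apply: filterS => y hy; rewrite /B big_seq big1 ?subr0 ?possq1 ?subrr//.
Qed.

End cutoff.

(** [PW] tests functions that are [C1] on the whole space, while under Assumption A the costs are
    smooth only near the support. Multiplying by a cutoff bridges the two. *)
Lemma C1_extension (R : realType) (d : nat) (S U : set 'rV[R]_d) f df :
  compact S -> S `<=` U -> C1_with U f df ->
  exists f' df', C1_with setT f' df' /\ forall x, S x -> f' x = f x.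
Proof.
move=> cS SU hf; have [oU _] := hf.
have [chi [dchi [hchi chi1 chi0]]] := cutoff cS oU SU.
have [_ H] := C1_withM (C1_with_open oU (@subsetT _ _) hchi) hf.
eexists (fun x => chi x * f x), _; split; last by move=> x /chi1 ->; rewrite mul1r.
split; first exact: openT.
move=> i x _; have [Ux|nUx] := pselect (U x); first exact: H i x Ux.
have h0 := chi0 x nUx.
have h1 : \forall y \near x, dchi i y = 0.
  have : \forall y \near x, \forall z \near y, chi z = 0 by exact: nbhs_interior.
  apply: filterS => y hy; have [_ hc] := hchi.
  have [[_ <-] _] := hc i y I.
  by rewrite (near_eq_derive _ hy) derive_cst.
split.
  apply: (@near_eq_is_derive R _ R (cst 0)).
    by apply: filterS h0 => y ->; rewrite mul0r.
  have -> : chi x * df i x + f x * dchi i x = 0.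
    by rewrite (nbhs_singleton h0) (nbhs_singleton h1) mul0r mulr0 addr0.
  exact: is_derive_cst.
apply/(@cvgrPdist_lt _ _ _ (nbhs x) (nbhs_filter x)) => eps eps0.
have [c0 c1] := (nbhs_singleton h0, nbhs_singleton h1).
apply: filterS2 h0 h1 => y hy0 hy1; rewrite hy0 hy1 c0 c1.
by rewrite !mul0r !mulr0 subrr normr0.
Qed.

(** * The Borel sets of R^d and null level sets *)

Section Rd_measurable.
Variables (R : realType) (d : nat).

Lemma Rd_open_measurable (A : set 'rV[R]_d) : open A -> measurable (A : set (Rd R d)).
Proof. by move=> oA; apply: sub_sigma_algebra. Qed.

Lemma Rd_closed_measurable (A : set 'rV[R]_d) : closed A -> measurable (A : set (Rd R d)).
Proof.
move=> cA; rewrite -[A]setCK; apply: measurableC.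
by apply: Rd_open_measurable; rewrite openC.
Qed.

Lemma Rd_continuous_measurable (f : 'rV[R]_d -> R) :
  continuous f -> measurable_fun setT (f : Rd R d -> R).
Proof.
move=> cf; apply: (measurability _ (RGenOInfty.measurableE R)) => // _ [_ [r ->] <-].
rewrite setTI; apply: Rd_open_measurable; move/continuousP: cf; apply.
exact: rray_open.
Qed.

(** A Lindelof argument: among the countably many balls with rational centres and radii
    [n.+1%:R^-1], those that meet [E] in a null set cover [E]. *)
Lemma Rd_locally_null (mu : {measure set (Rd R d) -> \bar R}) (E : set (Rd R d)) :
  measurable E ->
  (forall x : 'rV[R]_d, E x -> exists2 e : R, 0 < e & mu (E `&` ball x e) = 0) ->
  mu E = 0%E.
Proof.
move=> mE H.
pose B (q : 'rV[rat]_d) (n : nat) : set 'rV[R]_d := ball (map_mx (@ratr R) q : 'rV[R]_d) n.+1%:R^-1.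
have mB q n : measurable (B q n : set (Rd R d)).
  by apply: Rd_open_measurable; exact: ball_open.
pose F k : set (Rd R d) := if choice.unpickle k is Some (q, n) then
  (if mu (E `&` B q n) == 0%E then E `&` B q n else set0) else set0.
have hF k : mu.-negligible (F k).
  rewrite /F; case: choice.unpickle => [[q n]|]; last exact: negligible_set0.
  case: eqP => // [h|_]; last exact: negligible_set0.
  by apply/negligibleP => //; exact: measurableI.
apply: measure_negligible => //.
apply: (@negligibleS _ _ _ mu (\bigcup_k F k)); last exact: negligible_bigcup.
move=> x Ex; have [e e0 xe] := H x Ex.
have [n hn] : exists n : nat, n.+1%:R^-1 < e / 2.
  have := @near_infty_natSinv_lt R (PosNum (divr_gt0 e0 (ltr0n R 2))).
  by move=> [N _ /(_ N (leqnn N))] /= h; exists N.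
have /choice[q hq] (k : 'I_d) : exists q : rat, `|ratr q - x 0 k| < n.+1%:R^-1.
  have lt : x 0 k - n.+1%:R^-1 < x 0 k + n.+1%:R^-1 by rewrite ltrD2l gtrN.
  have [q] := rat_in_itvoo lt; rewrite in_itv/= => /andP[h1 h2]; exists q.
  by rewrite ltr_norml ltrBrDr ltrBlDr [- _ + _]addrC h1 [_ + x 0 k]addrC h2.
pose qv : 'rV[rat]_d := \row_k q k.
have xB : B qv n x by apply/rV_ball; split=> // k; rewrite !mxE.
have Bsub : B qv n `<=` ball x e.
  move=> z /rV_ball[_ hz]; apply/rV_ball; split=> // k.
  have := hz k; have := hq k; rewrite !mxE => h1 h2.
  rewrite (_ : _ - _ = (ratr (q k) - z 0 k) - (ratr (q k) - x 0 k)); last by ring.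
  by apply: le_lt_trans (ler_normB _ _) _; rewrite [e]splitr ltrD// (lt_trans _ hn).
exists (choice.pickle (qv, n)) => //; rewrite /F choice.pickleK.
rewrite ifT //; apply/eqP/(@subset_measure0 _ _ _ mu _ (E `&` ball x e)) => //.
- exact: measurableI.
- by apply: measurableI => //; apply: Rd_open_measurable; exact: ball_open.
- exact: setIS.
Qed.

End Rd_measurable.

Lemma measure_le_sum (dsp : measure_display) (T : measurableType dsp) (R : realType)
    (mu : {measure set T -> \bar R}) (I : finType) (A : set T) (B : I -> set T) :
  measurable A -> (forall i, measurable (B i)) -> A `<=` \bigcup_i B i ->
  (mu A <= \sum_i mu (B i))%E.
Proof.
move=> mA mB AB.
have mU r : measurable (\big[setU/set0]_(i <- r) B i) by exact: bigsetU_measurable.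
apply: (@le_trans _ _ (mu (\big[setU/set0]_i B i))).
  apply: le_measure; rewrite ?inE// => x /AB[i _ Bx].
  by rewrite -bigcup_seq; exists i => //=; rewrite mem_index_enum.
elim: (index_enum I) => [|i r IH]; first by rewrite !big_nil measure0.
rewrite !big_cons; apply: (le_trans (measureU2 _ (mB i) (mU r))).
exact: leeD2l.
Qed.

Lemma ord_cell (R : realType) (N : nat) (eta t : R) : 0 < eta -> 0 <= t ->
  t < eta * N%:R -> exists j : 'I_N, eta * j%:R <= t <= eta * j.+1%:R.
Proof.
move=> e0 t0 tN.
have h : 0 <= t / eta by rewrite divr_ge0// ltW.
have /andP[h1 h2] := truncn_itv h.
have lN : (Num.truncn (t / eta) < N)%N.
  by rewrite -(ltr_nat R) (le_lt_trans h1)// ltr_pdivrMr// mulrC.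
exists (Ordinal lN) => /=.
by rewrite mulrC -ler_pdivlMr// h1/= mulrC -ler_pdivrMr// ltW.
Qed.

(* Each of the [N ^ d] columns over the grid of the coordinates other than [i0]
   meets [E] in a piece of height [O(1/N)]. *)
Lemma lebesgue_graph_null (R : realType) (d : nat)
  (lam : {measure set (Rd R d.+1) -> \bar R}) (i0 : 'I_d.+1)
  (E : set (Rd R d.+1)) (p : 'rV[R]_d.+1) (r L : R) :
  is_lebesgue lam -> measurable E -> E `<=` ball p r -> 0 < r -> 0 <= L ->
  (forall x x' : 'rV[R]_d.+1, E x -> E x' -> forall e, 0 <= e -> (forall k, k != i0 -> `|x 0 k - x' 0 k| <= e) ->
     `|x 0 i0 - x' 0 i0| <= L * e) ->
  lam E = 0%E.
Proof.
move=> hlam mE Ep r0 L0 H.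
suff bound N : (0 < N)%N -> (lam E <= ((2 * r) ^+ d * (2 * L * (2 * r)) / N%:R)%:E)%E.
  apply/eqP; rewrite eq_le measure_ge0 andbT.
  apply/lee_addgt0Pr => e e0; rewrite add0e.
  set c := (2 * r) ^+ d * (2 * L * (2 * r)) in bound *.
  have c0 : 0 <= c by rewrite !mulr_ge0 ?exprn_ge0 ?mulr_ge0// ltW.
  have [n hn] : exists n : nat, c / e < n.+1%:R.
    by exists (Num.truncn (c / e)); rewrite truncnS_gt.
  apply: le_trans (bound n.+1 isT) _.
  by rewrite lee_fin ler_pdivrMr// mulrC -ler_pdivrMr// ltW.
move=> N0; pose eta := 2 * r / N%:R.
have eta0 : 0 < eta by rewrite divr_gt0 ?mulr_gt0// ltr0n.
pose T := {ffun 'I_d -> 'I_N}.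
pose G (s : T) : set 'rV[R]_d.+1 := [set x | E x /\ forall k : 'I_d,
   eta * (s k)%:R <= x 0 (lift i0 k) - p 0 (lift i0 k) + r <= eta * (s k).+1%:R].
have [z Hz] : {z : T -> R | forall s x, G s x -> z s - L * eta <= x 0 i0 <= z s + L * eta}.
  suff /choice[z Hz] : forall s, exists z, forall x, G s x -> z - L * eta <= x 0 i0 <= z + L * eta.
    by exists z.
  move=> s; have [[y Gy]|nG] := pselect (exists y, G s y); last first.
    by exists 0 => x Gx; exfalso; apply: nG; exists x.
  exists (y 0 i0) => x Gx.
  suff : `|x 0 i0 - y 0 i0| <= L * eta.
    by rewrite ler_norml => /andP[? ?]; apply/andP; split; lra.
  apply: H; [exact: Gx.1|exact: Gy.1|exact: ltW|] => k ki.
  have [j ->] : exists j, k = lift i0 j by case: (unliftP i0 k) ki => [j ->|->]; [exists j|rewrite eqxx].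
  have := Gx.2 j; have := Gy.2 j; rewrite -[in _.+1%:R]addn1 natrD mulrDr mulr1.
  move=> /andP[? ?] /andP[? ?]; rewrite ler_norml; apply/andP; split; lra.
pose lo (s : T) : 'rV[R]_d.+1 := \row_k
  if unlift i0 k is Some j then p 0 k - r + eta * (s j)%:R else z s - L * eta.
pose hi (s : T) : 'rV[R]_d.+1 := \row_k
  if unlift i0 k is Some j then p 0 k - r + eta * (s j).+1%:R else z s + L * eta.
pose box s : set (Rd R d.+1) := [set x : 'rV[R]_d.+1 | forall i, lo s 0 i <= x 0 i <= hi s 0 i].
have lohi s i : lo s 0 i <= hi s 0 i.
  rewrite !mxE; case: unlift => [j|]; first by rewrite lerD2l ler_pM2l// ler_nat.
  by rewrite lerD2l ge0_cp// mulr_ge0// ltW.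
have lbox s : lam (box s) = (eta ^+ d * (2 * L * eta))%:E.
  rewrite /box hlam//; congr (_%:E); rewrite (bigD1_ord i0)//= !mxE unlift_none mulrC.
  congr (_ * _); last by ring.
  rewrite (eq_bigr (fun=> eta)) ?prodr_const ?card_ord// => j _.
  by rewrite !mxE liftK -natr1; ring.
have mbox s : measurable (box s).
  apply: Rd_closed_measurable.
  rewrite (_ : box s = \bigcap_(i in [set: 'I_d.+1])
     ((fun x : 'rV[R]_d.+1 => x 0 i) @^-1` [set t | lo s 0 i <= t <= hi s 0 i])); last first.
    by apply/seteqP; split=> x h; [move=> i _; exact: h|move=> i; exact: (h i I)].
  apply: closed_bigI => i _; apply: preimage_closed; first by move=> x _; exact: coord_continuous.
  rewrite (_ : [set t | _] = `[lo s 0 i, hi s 0 i]%classic); first exact: interval_closed.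
  by apply/seteqP; split=> t /=; rewrite in_itv.
have sub : E `<=` \bigcup_(s in [set: T]) box s.
  move=> x Ex; have /rV_ball[_ hx] := Ep x Ex.
  have /choice[s hs] (k : 'I_d) : exists j : 'I_N,
      eta * j%:R <= x 0 (lift i0 k) - p 0 (lift i0 k) + r <= eta * j.+1%:R.
    have := hx (lift i0 k); rewrite ltr_norml => /andP[? ?].
    apply: ord_cell => //; first by lra.
    by rewrite /eta divfK ?pnatr_eq0 -?lt0n//; lra.
  have Gs : G [ffun k => s k] x by split=> // k; rewrite ffunE.
  exists [ffun k => s k] => //.
  move=> k; rewrite !mxE; case: unliftP => [j ->|->]; last exact: Hz.
  by have := Gs.2 j => /andP[? ?]; apply/andP; split; lra.
apply: (@le_trans _ _ (\sum_(s : T) lam (box s))%E).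
  exact: measure_le_sum.
rewrite (eq_bigr (fun=> (eta ^+ d * (2 * L * eta))%:E))//.
rewrite sumEFin lee_fin sumr_const card_ffun !card_ord -[leLHS]mulr_natl.
rewrite natrX [leLHS]mulrA -exprMn.
have N0' : N%:R != 0 :> R by rewrite pnatr_eq0 -lt0n.
rewrite (_ : N%:R * eta = 2 * r); last by rewrite /eta mulrC divfK.
by rewrite /eta !mulrA.
Qed.

(** No implicit function theorem is invoked: near [x0] the [i0] partial is at least [m] in absolute
    value and the others are at most [B]. The mean value expansion between two points of the level
    set then bounds the [i0] displacement by the others, so the set is a Lipschitz graph. *)
Lemma lebesgue_level_null (R : realType) (d : nat)
  (lam : {measure set (Rd R d) -> \bar R}) (U : set 'rV[R]_d) f df (i0 : 'I_d)
  (x0 : 'rV[R]_d) (E : set (Rd R d)) (t : R) :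
  is_lebesgue lam -> C1_with U f df -> U x0 -> df i0 x0 != 0 ->
  measurable E -> (forall x : 'rV[R]_d, E x -> f x = t) ->
  exists2 e : R, 0 < e & lam (E `&` ball x0 e) = 0%E.
Proof.
case: d lam U f df i0 x0 E => [|d] lam U f df i0 x0 E hlam hf Ux df0 mE Et; first by case: i0 df0.
have [e1 [B [e10 B0 eU HB]]] := C1_with_locally_bounded hf Ux.
pose m := `|df i0 x0| / 2.
have m0 : 0 < m by rewrite divr_gt0 ?normr_gt0.
have [e2 /= e20 He2] : exists2 e : R, 0 < e & forall y, ball x0 e y -> m <= `|df i0 y|.
  have [_ /(_ i0 x0 Ux)[_ /cvgr_dist_lt /(_ m m0)]] := hf.
  move=> /nbhs_ballP[e /= e0 He]; exists e => // y /He /=.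
  have := ler_normD (df i0 y) (df i0 x0 - df i0 y).
  rewrite addrC subrK -[`|df i0 x0|](divfK (_ : 2 != 0 :> R))// -/m; lra.
pose e := Num.min e1 e2.
have e0 : 0 < e by rewrite lt_min e10.
have mEb : measurable (E `&` ball x0 e : set (Rd R d.+1)).
  by apply: measurableI => //; apply: Rd_open_measurable; exact: ball_open.
exists e => //; apply: (lebesgue_graph_null (p := x0) (i0 := i0) (r := e) (L := d.+1%:R * B / m)) => //.
- by rewrite divr_ge0 ?mulr_ge0// ltW.
move=> x x' [Ex bx] [Ex' bx'] h h0 H.
have bU : ball x0 e `<=` U.
  by move=> y hy; apply: eU; apply: le_ball hy; rewrite ge_min lexx.
have [xi [hxi]] := box_mean_value hf bU bx' bx.
rewrite !Et// subrr (bigD1 i0)//= => /esym/eqP; rewrite addr_eq0 => /eqP E0.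
have : `|df i0 (xi i0) * (x 0 i0 - x' 0 i0)| <= \sum_(i < d.+1) B * h.
  rewrite E0 normrN; apply: (le_trans (ler_norm_sum _ _ _)).
  apply: (@le_trans _ _ (\sum_(i < d.+1 | i != i0) B * h)).
    apply: ler_sum => i ii0; rewrite normrM ler_pM//; last exact: H.
    by apply: HB; apply: le_ball (hxi i); rewrite ge_min lexx.
  by rewrite [leRHS](bigD1 i0)//= lerDr mulr_ge0.
rewrite normrM sumr_const card_ord -[_ *+ _]mulr_natl => hh.
have hm : m <= `|df i0 (xi i0)|.
  by apply: He2; apply: le_ball (hxi i0); rewrite ge_min lexx orbT.
rewrite (_ : d.+1%:R * B / m * h = d.+1%:R * (B * h) / m); last by ring.
rewrite ler_pdivlMr// mulrC; apply: le_trans hh.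
by rewrite ler_wpM2r.
Qed.

(** * A Poincare-Wirtinger bound for interfaces *)

Section separator.
Variables (R : realType) (d M : nat) (S : {set 'I_M}) (delta : R).
Variables (a : 'I_M -> 'rV[R]_d -> R) (da : 'I_M -> 'I_d -> 'rV[R]_d -> R).
Hypothesis delta0 : 0 < delta.
Hypothesis ha : forall i, C1_with setT (a i) (da i).

(** Equals [1] when no index outside [S] exceeds [a i x], and is at most [0] once one of them
    exceeds it by [delta]. *)
Definition dominance (i : 'I_M) (x : 'rV[R]_d) : R :=
  1 - \sum_(j in ~: S) possq (delta^-1 * (a j x - a i x)).

Definition ddominance (i : 'I_M) (k : 'I_d) (x : 'rV[R]_d) : R :=
  0 - \sum_(j in ~: S) 2 * Num.max (delta^-1 * (a j x - a i x)) 0 *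
      (delta^-1 * (da j k x - da i k x)).

(* Equals [1] where some index of [S] attains the maximum of the [a i], and [0] where every
   index of [S] is beaten by at least [delta] by an index outside [S]. *)
Definition separator (x : 'rV[R]_d) : R := 1 - possq (1 - \sum_(i in S) possq (dominance i x)).

Definition dseparator (k : 'I_d) (x : 'rV[R]_d) : R :=
  0 - 2 * Num.max (1 - \sum_(i in S) possq (dominance i x)) 0 *
  (0 - \sum_(i in S) 2 * Num.max (dominance i x) 0 * ddominance i k x).

Lemma C1_with_separator : C1_with setT separator dseparator.
Proof.
have c1 : C1_with setT (cst 1 : 'rV[R]_d -> R) (fun _ => cst 0).
  by apply: C1_with_cst; exact: openT.
apply: C1_withB => //; apply: C1_with_possq; apply: C1_withB => //.
apply: C1_with_sum; first exact: openT.
move=> i _; apply: C1_with_possq; apply: C1_withB => //.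
apply: C1_with_sum; first exact: openT.
move=> j _; apply: C1_with_possq; apply: C1_withZ; exact: C1_withB.
Qed.

(** The derivative of [possq] is [0] at [0], so the gradient vanishes on the closed flat regions,
    boundary included. This is what confines it to the slab. *)
Lemma separator_eq1 x i : i \in S -> (forall j, j \notin S -> a j x <= a i x) ->
  separator x = 1 /\ forall k, dseparator k x = 0.
Proof.
move=> iS H.
have h : 1 - \sum_(i in S) possq (dominance i x) <= 0.
  rewrite subr_le0 (bigD1 i)//= [X in possq X]/dominance big1.
    by rewrite subr0 possq1 lerDl sumr_ge0// => j _; exact: possq_ge0.
  move=> j; rewrite inE => /H h; rewrite possq_le0// mulr_ge0_le0//.
    by rewrite invr_ge0 ltW.
  by rewrite subr_le0.
split; first by rewrite /separator possq_le0 ?subr0.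
by move=> k; rewrite /dseparator max_r// mulr0 mul0r subr0.
Qed.

Lemma separator_eq0 x :
  (forall i, i \in S -> exists2 j, j \notin S & delta <= a j x - a i x) ->
  separator x = 0 /\ forall k, dseparator k x = 0.
Proof.
move=> H.
have h i : i \in S -> dominance i x <= 0.
  move=> /H[j jS hj]; rewrite subr_le0 (bigD1 j) ?inE//=.
  apply: ler_wpDr; first by apply: sumr_ge0 => *; exact: possq_ge0.
  by apply: possq_ge1; rewrite mulrC ler_pdivlMr// mul1r.
split; first by rewrite /separator big1 ?subr0 ?possq1 ?subrr// => i /h /possq_le0.
move=> k; rewrite /dseparator.
have -> : \sum_(i in S) 2 * Num.max (dominance i x) 0 * ddominance i k x = 0.
  by rewrite big1// => i /h hi; rewrite max_r// mulr0 mul0r.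
by rewrite subr0 mulr0 subr0.
Qed.

(** The three nested [possq] contribute a factor [2] each, and the two sums a factor [M] each. *)
Lemma dseparator_bound x (L : R) k :
  0 <= L -> (forall i j, `|da i k x - da j k x| <= L) ->
  `|dseparator k x| <= 8 * M%:R ^+ 2 * L / delta.
Proof.
move=> L0 HL.
have cardM (A : {set 'I_M}) : (#|A|%:R <= M%:R :> R) by rewrite ler_nat -[leqRHS]card_ord max_card.
have m01 (A : {set 'I_M}) (F : 'I_M -> R) :
    0 <= Num.max (1 - \sum_(i in A) possq (F i)) 0 <= 1.
  rewrite le_max lexx orbT/= ge_max ler01 andbT gerBl sumr_ge0// => i _; exact: possq_ge0.
rewrite /dseparator sub0r normrN sub0r normrM normrN.
have /andP[h0 h1] := m01 S (fun i => dominance i x).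
rewrite normrM (ger0_norm h0) (ger0_norm (ler0n _ 2)).
apply: (@le_trans _ _ (2 * (M%:R * (4 * (M%:R * (L / delta)))))); last first.
  by rewrite le_eqVlt; apply/orP; left; apply/eqP; ring.
apply: ler_pM => //; first by rewrite mulr_ge0.
  by rewrite -[leRHS]mulr1 ler_pM2l.
apply: (le_trans (ler_norm_sum _ _ _)).
apply: (@le_trans _ _ (\sum_(i in S) 4 * (M%:R * (L / delta)))); last first.
  rewrite sumr_const -[leLHS]mulr_natl ler_wpM2r// !mulr_ge0// invr_ge0 ltW//.
apply: ler_sum => i _.
rewrite /ddominance sub0r mulrN normrN mulr_sumr.
apply: (le_trans (ler_norm_sum _ _ _)).
apply: (@le_trans _ _ (\sum_(j in ~: S) 4 * (L / delta))); last first.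
  by rewrite sumr_const -[leLHS]mulr_natl mulrCA ler_wpM2l// ler_wpM2r// mulr_ge0// invr_ge0 ltW.
apply: ler_sum => j jS.
set u := delta^-1 * (a j x - a i x); set v := dominance i x.
have /andP[v0 v1] : 0 <= Num.max v 0 <= 1 by exact: m01.
(* The positive part of [u] alone is unbounded, but once [u] exceeds [1] the index [i] is dominated
   and the other factor is [0]. *)
have vu : Num.max v 0 * Num.max u 0 <= 1.
  have [u1|u1] := leP u 1.
    by rewrite mulr_ile1// ?le_max ?lexx ?orbT// ge_max u1 ler01.
  rewrite (_ : Num.max v 0 = 0) ?mul0r//; apply: max_r.
  rewrite /v /dominance subr_le0 (bigD1 j)//=.
  apply: ler_wpDr; first by apply: sumr_ge0 => *; exact: possq_ge0.
  exact/possq_ge1/ltW.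
have vu0 : 0 <= Num.max v 0 * Num.max u 0 by rewrite mulr_ge0// le_max lexx orbT.
rewrite [X in `|X|](_ : _ = 4 * (Num.max v 0 * Num.max u 0) * ((da j k x - da i k x) / delta)); last by ring.
rewrite normrM ger0_norm; last by rewrite mulr_ge0.
rewrite -mulrA ler_wpM2l// -[leRHS]mul1r ler_pM//.
rewrite normrM normfV (gtr0_norm delta0) ler_wpM2r//.
by rewrite invr_ge0 ltW.
Qed.

End separator.

Lemma measurable_enorm (R : realType) (d : nat) (G : 'rV[R]_d -> 'rV[R]_d) :
  (forall k, measurable_fun setT ((fun x => G x 0 k) : Rd R d -> R)) ->
  measurable_fun setT ((fun x => enorm (G x)) : Rd R d -> R).
Proof.
move=> mG; rewrite /enorm.
apply: (@measurableT_comp _ _ _ _ _ _ (@Num.sqrt R)).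
  by apply: continuous_measurable_fun; exact: sqrt_continuous.
by apply: measurable_sum => k; apply: measurable_funX.
Qed.

Lemma enorm_le (R : realType) (d : nat) (x : 'rV[R]_d) (B : R) :
  0 <= B -> (forall k, `|x 0 k| <= B) -> enorm x <= d%:R * B.
Proof.
move=> B0 H; rewrite -[leRHS]ger0_norm ?mulr_ge0// -sqrtr_sqr ler_wsqrtr//.
apply: (@le_trans _ _ (\sum_(i < d) B ^+ 2)).
  by apply: ler_sum => i _; rewrite -[x 0 i ^+ 2]real_normK ?num_real// lerXn2r ?nnegrE.
rewrite sumr_const card_ord -[leLHS]mulr_natl exprMn ler_wpM2r ?sqr_ge0//.
by rewrite -natrX ler_nat; case: (d) => // n; rewrite leq_pmulr.
Qed.

Section separator_integral.
Variables (R : realType) (d M : nat) (S : {set 'I_M}) (delta L : R).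
Variables (a : 'I_M -> 'rV[R]_d -> R) (da : 'I_M -> 'I_d -> 'rV[R]_d -> R).
Variable rho : {measure set (Rd R d) -> \bar R}.
Variables (D A1 A0 Sl : set (Rd R d)).
Hypotheses (mD : measurable D) (mA1 : measurable A1) (mA0 : measurable A0)
  (mSl : measurable Sl) (rhoD : rho (~` D) = 0%E).
Hypotheses (delta0 : 0 < delta) (L0 : 0 <= L).
Hypothesis ha : forall i, C1_with setT (a i) (da i).
Hypothesis da_bound : forall (x : 'rV[R]_d) i j k, D x -> `|da i k x - da j k x| <= L.
Hypothesis A1P : forall x : 'rV[R]_d, D x -> A1 x ->
  exists2 i, i \in S & forall j, j \notin S -> a j x <= a i x.
Hypothesis A0P : forall x : 'rV[R]_d, D x -> A0 x ->
  forall i, i \in S -> exists2 j, j \notin S & delta <= a j x - a i x.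
Hypothesis SlP : forall x : 'rV[R]_d, D x -> ~ Sl x -> A1 x \/ A0 x.

Let F := separator S delta a.
Let KL := d%:R * (8 * M%:R ^+ 2 * L / delta).

Let KL0 : 0 <= KL.
Proof. by rewrite !mulr_ge0// ?exprn_ge0// invr_ge0 ltW. Qed.

Let aeD (Q : Rd R d -> Prop) : (forall x, D x -> Q x) -> {ae rho, forall x, setT x -> Q x}.
Proof.
move=> H; exists (~` D); split=> //; first exact: measurableC.
by move=> x /= nQ Dx; apply: nQ => _; exact: H.
Qed.

Let int1 (A : set (Rd R d)) : measurable A -> (\int[rho]_x (\1_A x : R)%:E = rho A)%E.
Proof. by move=> mA; rewrite integral_indic// setIT. Qed.

Lemma integral_grad_separator :
  (\int[rho]_x (enorm (grad F x))%:E <= KL%:E * rho Sl)%E.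
Proof.
have [_ dF] := C1_with_C1 (C1_with_separator S delta ha).
have hF := C1_with_separator S delta ha.
rewrite -(int1 mSl) -ge0_integralZl//; last first.
  by apply/measurable_EFinP; exact: measurable_indic.
apply: ae_ge0_le_integral => //.
- by move=> x _; rewrite lee_fin sqrtr_ge0.
- apply/measurable_EFinP; apply: measurable_enorm => k.
  rewrite (_ : (fun x => _) = dseparator S delta a da k); last first.
    by apply/funext => x; rewrite /grad mxE dF.
  by apply: Rd_continuous_measurable => x; have [_ H] := hF; exact: (H k x I).2.
- by move=> x _; rewrite lee_fin mulr_ge0.
- apply: emeasurable_funM => //.
  by apply/measurable_EFinP; exact: measurable_indic.
apply: aeD => x Dx; rewrite -EFinM lee_fin indicE.
have [/set_mem Sx|/negP nS] := boolP (x \in Sl).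
  rewrite mulr1; apply: enorm_le => [|k]; first by rewrite !mulr_ge0// ?exprn_ge0// invr_ge0 ltW.
  by rewrite /grad mxE dF; apply: dseparator_bound => // i j; exact: da_bound.
rewrite mulr0 -[leRHS](mulr0 d%:R); apply: enorm_le => // k.
rewrite /grad mxE dF.
have [|/(A1P Dx)[i iS h]|/(A0P Dx) h] := SlP Dx.
- by move=> Sx; apply: nS; exact/mem_set.
- by rewrite (separator_eq1 da delta0 iS h).2 normr0.
- by rewrite (separator_eq0 da delta0 h).2 normr0.
Qed.

(** Whatever the centre [m], the deviations [|1 - m|] on [A1] and [|m|] on [A0] add up to at least
    [1], so the mean of the separator need not be known. *)
Lemma integral_dev_separator (p m : R) : 0 <= p ->
  (p%:E <= rho A1)%E -> (p%:E <= rho A0)%E ->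
  (p%:E <= \int[rho]_x (`|F x - m|)%:E)%E.
Proof.
move=> p0 p1 p2.
have hF := C1_with_separator S delta ha.
have mF : measurable_fun setT (F : Rd R d -> R).
  by apply: Rd_continuous_measurable => x; exact: C1_with_continuous hF I.
apply: (@le_trans _ _ (\int[rho]_x ((`|1 - m|)%:E * (\1_A1 x)%:E + (`|m|)%:E * (\1_A0 x)%:E))%E).
  have mi (A : set (Rd R d)) : measurable A -> measurable_fun setT (fun x => (\1_A x : R)%:E).
    by move=> mA; apply/measurable_EFinP; exact: measurable_indic.
  have mk (k : R) (A : set (Rd R d)) : measurable A ->
      measurable_fun setT (fun x => k%:E * (\1_A x : R)%:E)%E.
    by move=> mA; apply: emeasurable_funM => //; exact: mi.
  have k0 (k : R) (A : set (Rd R d)) x : (0 <= `|k|%:E * (\1_A x : R)%:E)%E.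
    by rewrite mule_ge0// lee_fin.
  rewrite ge0_integralD//=; [|exact: mk|exact: mk].
  rewrite !ge0_integralZl ?int1//; try exact: mi.
  apply: (@le_trans _ _ (`|1 - m|%:E * p%:E + `|m|%:E * p%:E)%E); last first.
    by apply: leeD; apply: lee_pmul => //; rewrite lee_fin.
  rewrite -!EFinM -EFinD lee_fin -mulrDl -[leLHS]mul1r ler_wpM2r//.
  by rewrite -[leLHS]normr1 -[X in `|X| <= _](subrK m) ler_normD.
apply: ae_ge0_le_integral => //.
- by move=> x _; rewrite adde_ge0// mule_ge0// lee_fin.
- apply: emeasurable_funD; apply: emeasurable_funM => //;
    by apply/measurable_EFinP; exact: measurable_indic.
- by apply/measurable_EFinP; apply: measurableT_comp => //; apply: measurable_funB.
apply: aeD => x Dx; rewrite -!EFinM -EFinD lee_fin !indicE.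
have [/set_mem /(A1P Dx)[i iS h1]|] := boolP (x \in A1).
  have -> : (x \in A0) = false.
    apply/negP => /set_mem /(A0P Dx)/(_ i iS)[j jS hj].
    by have := h1 j jS; move: delta0 hj; lra.
  by rewrite mulr0 addr0 mulr1 /F (separator_eq1 da delta0 iS h1).1.
have [/set_mem /(A0P Dx) h0 _|_ _] := boolP (x \in A0).
  by rewrite mulr0 add0r mulr1 /F (separator_eq0 da delta0 h0).1 sub0r normrN.
by rewrite !mulr0 addr0.
Qed.

Lemma PW_separation (Cpw p : R) : 0 <= Cpw -> 0 <= p ->
  (forall f : 'rV[R]_d -> R, C1 f ->
    (\int[rho]_x (`| f x - fine (\int[rho]_z (f z)%:E) |)%:E
      <= Cpw%:E * \int[rho]_x (enorm (grad f x))%:E)%E) ->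
  (p%:E <= rho A1)%E -> (p%:E <= rho A0)%E ->
  (p%:E <= (Cpw * KL)%:E * rho Sl)%E.
Proof.
move=> C0 p0 H p1 p2.
have [cF _] := C1_with_C1 (C1_with_separator S delta ha).
apply: (le_trans (integral_dev_separator (fine (\int[rho]_z (F z)%:E)) p0 p1 p2)).
apply: (le_trans (H F cF)).
by rewrite EFinM -muleA lee_wpmul2l ?lee_fin//; exact: integral_grad_separator.
Qed.

End separator_integral.

(** * Laguerre cells *)

Lemma minI_le (R : realType) (M : nat) (F : 'I_M -> R) i : minI F <= F i.
Proof. exact: bigmin_le_cond. Qed.

Lemma minI_attained (R : realType) (M : nat) (F : 'I_M -> R) (i0 : 'I_M) :
  exists i, minI F = F i.
Proof.
rewrite /minI; elim/big_ind: _ => [|x1 x2 [i ->] [j ->]|i _]; last by exists i.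
  have : i0 \in enum 'I_M by rewrite mem_enum.
  by case: (enum 'I_M) => // j s _; exists j.
by case: (leP (F i) (F j)) => _; [exists i|exists j].
Qed.

(** * Real-valued probabilities and finite unions *)

Section measure_sums.
Context (dsp : measure_display) (T : measurableType dsp) (R : realType).
Variable mu : probability T R.

Definition rmeas (A : set T) : R := fine (mu A).

Lemma rmeasE A : measurable A -> mu A = (rmeas A)%:E.
Proof. by move=> mA; rewrite /rmeas fineK// fin_num_measure. Qed.

Lemma rmeas_ge0 A : 0 <= rmeas A.
Proof. by rewrite /rmeas fine_ge0. Qed.

Lemma rmeas_le A B : measurable A -> measurable B -> A `<=` B -> rmeas A <= rmeas B.
Proof.
by move=> mA mB AB; rewrite -lee_fin -!rmeasE//; apply: le_measure; rewrite ?inE.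
Qed.

Lemma rmeasT : rmeas setT = 1.
Proof. by rewrite /rmeas probability_setT. Qed.

Lemma rmeas_le_sum (I : finType) (A : set T) (B : I -> set T) :
  measurable A -> (forall i, measurable (B i)) -> A `<=` \bigcup_i B i ->
  rmeas A <= \sum_i rmeas (B i).
Proof.
move=> mA mB AB; rewrite -lee_fin -rmeasE// -sumEFin.
apply: (le_trans (measure_le_sum mu mA mB AB)).
by apply: lee_sum => i _; rewrite -(rmeasE (mB i)).
Qed.

Lemma rmeasU_le (A B : set T) : measurable A -> measurable B ->
  rmeas (A `|` B) <= rmeas A + rmeas B.
Proof.
move=> mA mB; rewrite -lee_fin EFinD -!rmeasE//; last exact: measurableU.
exact: measureU2.
Qed.

Lemma rmeas_disjoint_sum (I : finType) (B : I -> set T) (P : pred I) :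
  (forall i, measurable (B i)) -> (forall i j x, B i x -> B j x -> i = j) ->
  rmeas (\bigcup_(i in [set i | P i]) B i) = \sum_(i | P i) rmeas (B i).
Proof.
move=> mB dB.
have mU (r : seq I) : measurable (\bigcup_(i in [set i | i \in r /\ P i]) B i).
  by apply: fin_bigcup_measurable => // ; exact: finite_finset.
have H r : uniq r -> rmeas (\bigcup_(i in [set i | i \in r /\ P i]) B i) =
    \sum_(i <- r | P i) rmeas (B i).
  elim: r => [_|i r IH /= /andP[ir ur]].
    rewrite big_nil (_ : \bigcup_(_ in _) _ = set0) ?/rmeas ?measure0//.
    by apply/seteqP; split=> // x [j []]; rewrite in_nil.
  rewrite big_cons; case: ifPn => Pi; last first.
    rewrite -IH//; congr rmeas; apply/seteqP; split=> x [j [jr Pj] Bj].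
      move: jr; rewrite inE => /orP[/eqP ji|jr]; last by exists j.
      by move: Pi; rewrite -ji Pj.
    by exists j => //; split=> //; rewrite inE jr orbT.
  rewrite -IH//.
  have -> : \bigcup_(j in [set j | j \in i :: r /\ P j]) B j =
      B i `|` \bigcup_(j in [set j | j \in r /\ P j]) B j.
    apply/seteqP; split=> x.
      move=> [j [jr Pj] Bj]; move: jr; rewrite inE => /orP[/eqP <-|jr]; first by left.
      by right; exists j.
    move=> [Bi|[j [jr Pj] Bj]]; first by exists i => //; split=> //; rewrite inE eqxx.
    by exists j => //; split=> //; rewrite inE jr orbT.
  apply: EFin_inj; rewrite EFinD -!rmeasE//; last exact: measurableU.
  rewrite measureU//; apply/seteqP; split=> // x [Bi [j [jr _] Bj]].
  by move: ir; rewrite (dB _ _ _ Bi Bj) jr.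
rewrite -H ?index_enum_uniq//; congr rmeas; apply/seteqP; split=> x [j].
  by move=> Pj Bj; exists j => //; split=> //; rewrite mem_index_enum.
by move=> [_ Pj] Bj; exists j.
Qed.

End measure_sums.

Section cells.
Variables (R : realType) (d M : nat) (c : 'rV[R]_d -> 'rV[R]_d -> R) (y : 'I_M -> 'rV[R]_d).
Hypothesis hcm : forall j, measurable_fun [set: Rd R d] (fun x : Rd R d => c x (y j)).
Implicit Types (g : 'I_M -> R) (x : 'rV[R]_d).

Definition cell g j : set (Rd R d) := Lcell c y g j.

Lemma LcellP g j x : Lcell c y g j x <-> forall i, c x (y j) - g j <= c x (y i) - g i.
Proof.
rewrite /Lcell /ctrans /=; split=> [<- i|H]; first exact: (minI_le (fun i => c x (y i) - g i)).
apply/eqP; rewrite eq_le (minI_le (fun i => c x (y i) - g i))/=.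
by have [k ->] := minI_attained (fun i => c x (y i) - g i) j.
Qed.

Lemma Lcell_cover (i0 : 'I_M) g x : exists j, Lcell c y g j x.
Proof. by have [k e] := minI_attained (fun i => c x (y i) - g i) i0; exists k. Qed.

Lemma measurable_cell g j : measurable (cell g j).
Proof.
rewrite (_ : cell g j = \bigcap_(i in [set: 'I_M])
    [set x : Rd R d | (c x (y j) - g j <= c x (y i) - g i) ]); last first.
  apply/seteqP; split=> x; first by move=> /LcellP h i _; exact: h.
  by move=> h; apply/LcellP => i; exact: h.
apply: fin_bigcap_measurable => [|i _]; first exact: finite_finset.
rewrite -[X in measurable X]setTI; apply: measurable_fun_le => //;
  by apply: measurable_funB.
Qed.

Lemma measurable_cells g (P : pred 'I_M) : measurable (\bigcup_(i in [set i | P i]) cell g i).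
Proof.
by apply: fin_bigcup_measurable => [|i _]; [exact: finite_finset|exact: measurable_cell].
Qed.

Variable mu : probability (Rd R d) R.
Notation m := (rmeas mu).

Hypothesis tie_null : forall i k (t : R), i != k ->
  mu [set x : Rd R d | c x (y i) - c x (y k) = t] = 0%E.

Lemma cellI_null g i k : i != k -> m (cell g i `&` cell g k) = 0.
Proof.
move=> ik; apply: EFin_inj; rewrite -rmeasE; last by apply: measurableI; exact: measurable_cell.
apply/(subset_measure0 _ _ _ (tie_null (g i - g k) ik)).
- by apply: measurableI; exact: measurable_cell.
- rewrite -[X in measurable X]setTI.
  have mf : measurable_fun setT (fun x : Rd R d => c x (y i) - c x (y k)).
    exact: measurable_funB.
  exact: (mf measurableT [set (g i - g k)] (measurable_set1 _)).
- move=> x [/LcellP h1 /LcellP h2] /=.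
  by have := h1 k; have := h2 i; lra.
Qed.

(** Cells overlap only in ties; deleting the null set [Tie] makes them disjoint and keeps their
    masses. *)
Lemma sum_rmeas_cells (i0 : 'I_M) g (E : set (Rd R d)) : measurable E ->
  \sum_j m (E `&` cell g j) = m E.
Proof.
move=> mE; apply/eqP; rewrite eq_le; apply/andP; split; last first.
  apply: rmeas_le_sum => // [j|x Ex]; first by apply: measurableI => //; exact: measurable_cell.
  by have [j hj] := Lcell_cover i0 g x; exists j.
pose Tie := \bigcup_(p in [set p : 'I_M * 'I_M | p.1 != p.2]) (cell g p.1 `&` cell g p.2).
have mTie : measurable Tie.
  apply: fin_bigcup_measurable => [|p _]; first exact: finite_finset.
  by apply: measurableI; exact: measurable_cell.
have Tie0 : m Tie = 0.
  apply/eqP; rewrite eq_le rmeas_ge0 andbT.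
  pose B (p : 'I_M * 'I_M) := if p.1 != p.2 then cell g p.1 `&` cell g p.2 else set0.
  have -> : 0 = \sum_p m (B p).
    apply/esym/big1 => p _; rewrite /B; case: ifP => [h|_]; first exact: cellI_null.
    by rewrite /rmeas measure0.
  apply: rmeas_le_sum => // [p|x [p /= hp hx]].
    by rewrite /B; case: ifP => // _; apply: measurableI; exact: measurable_cell.
  by exists p => //; rewrite /B hp.
have mT j : measurable (E `&` cell g j `\` Tie).
  by apply: measurableD => //; apply: measurableI => //; exact: measurable_cell.
apply: (@le_trans _ _ (\sum_j m (E `&` cell g j `\` Tie))).
  apply: ler_sum => j _; rewrite -[leRHS]addr0 -Tie0.
  apply: le_trans (rmeasU_le _ (mT j) mTie).
  apply: rmeas_le.
  - by apply: measurableI => //; exact: measurable_cell.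
  - exact: measurableU.
  - by move=> x h; have [t|t] := pselect (Tie x); [right|left].
rewrite -(@rmeas_disjoint_sum _ _ _ mu _ (fun j => E `&` cell g j `\` Tie) xpredT) => //.
- apply: rmeas_le => //; last by move=> x [j _ [[]]].
  by apply: fin_bigcup_measurable => // ; exact: finite_finset.
- move=> i j x [[_ ci] nT] [[_ cj] _]; apply/eqP; apply: contra_notT nT => ij.
  by exists (i, j).
Qed.

Lemma sum_rmeas_cell (i0 : 'I_M) g : \sum_j m (cell g j) = 1.
Proof.
rewrite -(rmeasT mu) -(sum_rmeas_cells i0 g measurableT).
by apply: eq_bigr => j _; rewrite setTI.
Qed.

(** The costs cancel between the two cell inequalities: a point can only move to an index with at
    least as large an increment. Every term of the joint tally gets its sign from this. *)
Lemma cell_monotone g g' l j x : cell g l x -> cell g' j x -> g j - g' j <= g l - g' l.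
Proof. by move=> /LcellP /(_ j) h1 /LcellP /(_ l) h2; lra. Qed.

Definition slab (S : {set 'I_M}) g g' : set (Rd R d) :=
  (\bigcup_(j in [set j | j \notin S]) cell g' j) `&` (\bigcup_(i in [set i | i \in S]) cell g i).

Lemma measurable_slab S g g' : measurable (slab S g g').
Proof.
by apply: measurableI; [exact: (measurable_cells g' (fun j => j \notin S))|
  exact: (measurable_cells g (fun j => j \in S))].
Qed.

Lemma slab_le_monotone (i0 : 'I_M) (S : {set 'I_M}) g g' (delta : R) : 0 <= delta ->
  (forall i j, i \in S -> j \notin S -> delta <= (g i - g' i) - (g j - g' j)) ->
  delta * m (slab S g g') <= \sum_j (g j - g' j) * (m (cell g j) - m (cell g' j)).
Proof.
move=> d0 H; pose v j := g j - g' j; pose q l j := m (cell g l `&` cell g' j).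
have mq l j : measurable (cell g l `&` cell g' j) by apply: measurableI; exact: measurable_cell.
have q0 l j : 0 <= q l j by exact: rmeas_ge0.
have -> : \sum_j (g j - g' j) * (m (cell g j) - m (cell g' j)) =
    \sum_l \sum_j q l j * (v l - v j).
  transitivity (\sum_l v l * m (cell g l) - \sum_j v j * m (cell g' j)).
    by rewrite -sumrB; apply: eq_bigr => j _; rewrite mulrBr.
  have -> : \sum_l v l * m (cell g l) = \sum_l \sum_j q l j * v l.
    apply: eq_bigr => l _; rewrite -mulr_suml mulrC /q; congr (_ * _).
    by rewrite sum_rmeas_cells//; exact: measurable_cell.
  have -> : \sum_j v j * m (cell g' j) = \sum_l \sum_j q l j * v j.
    rewrite exchange_big/=; apply: eq_bigr => j _; rewrite -mulr_suml mulrC /q; congr (_ * _).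
    rewrite -(sum_rmeas_cells i0 g (measurable_cell g' j)).
    by apply: eq_bigr => l _; rewrite setIC.
  rewrite -sumrB; apply: eq_bigr => l _; rewrite -sumrB; apply: eq_bigr => j _.
  by rewrite [RHS]mulrBr.
have qv l j : 0 <= q l j * (v l - v j).
  have [[x [h1 h2]]|ne] := pselect (exists x, (cell g l `&` cell g' j) x).
    by rewrite mulr_ge0// subr_ge0; exact: cell_monotone h1 h2.
  rewrite /q (_ : _ `&` _ = set0) ?/rmeas ?measure0 ?mul0r//.
  by apply/seteqP; split=> // x h; exfalso; apply: ne; exists x.
(* Only the pairs that cross into [S] are kept; each has [v l - v j] at least [delta], and the
   dropped terms are nonnegative. *)
pose B (p : 'I_M * 'I_M) := if (p.1 \in S) && (p.2 \notin S) then cell g p.1 `&` cell g' p.2 else set0.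
apply: (@le_trans _ _ (delta * \sum_p m (B p))).
  rewrite ler_wpM2l//; apply: rmeas_le_sum; first exact: measurable_slab.
    by move=> p; rewrite /B; case: ifP.
  by move=> x [[j /= jS hj] [l /= lS hl]]; exists (l, j) => //; rewrite /B /= lS jS.
rewrite pair_big/= mulr_sumr; apply: ler_sum => -[l j] _; rewrite /B/=.
case: ifPn => [/andP[lS jS]|_]; last by rewrite /rmeas measure0 mulr0.
have h := H l j lS jS.
by rewrite mulrC; apply: ler_wpM2l; [exact: q0|exact: h].
Qed.

End cells.

(** The separator for [gs - ct] at scale [delta] is [1] on the cells of [gs] in [S]. On a cell of
    [g] outside [S] the gap [delta] between the increments forces the value [0]. What remains is the
    slab, and [PW] bounds its mass from below. *)
Lemma slab_lower_bound (R : realType) (d M : nat)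
  (c : 'rV[R]_d -> 'rV[R]_d -> R) (y : 'I_M -> 'rV[R]_d)
  (hcm : forall j, measurable_fun [set: Rd R d] (fun x : Rd R d => c x (y j)))
  (mu : probability (Rd R d) R) (rho : {measure set (Rd R d) -> \bar R})
  (kappa wm L : R) (D : set (Rd R d)) (ct : 'I_M -> 'rV[R]_d -> R) dct (gs : 'I_M -> R) :
  PW rho -> 0 < kappa -> 0 < wm -> 0 <= L ->
  (forall A, measurable A -> (rho A <= kappa%:E * mu A)%E) ->
  (forall A, measurable A -> (mu A <= rho A + (wm / 4)%:E)%E) ->
  measurable D -> rho (~` D) = 0%E ->
  (forall i, C1_with setT (ct i) (dct i)) ->
  (forall (x : 'rV[R]_d) i, D x -> ct i x = c x (y i)) ->
  (forall (x : 'rV[R]_d) i j k, D x -> `|dct i k x - dct j k x| <= L) ->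
  (forall j, wm <= rmeas mu (cell c y gs j)) ->
  forall Bd : R, 0 < Bd -> exists2 sigma, 0 < sigma &
    forall (g : 'I_M -> R) (S : {set 'I_M}) delta i0 j0, 0 < delta -> delta <= Bd ->
      i0 \in S -> j0 \notin S ->
      (forall i j, i \in S -> j \notin S -> delta <= (g i - gs i) - (g j - gs j)) ->
      sigma * delta <= rmeas mu (slab c y S g gs).
Proof.
move=> [Cpw0 hPW0] k0 w0 L0 rho_le mu_le mD rhoD hct ctE dct_bd hw Bd Bd0.
(* [PW] gives no sign for its constant. *)
pose Cpw := Num.max Cpw0 0.
have Cpw_ge0 : 0 <= Cpw by rewrite le_max lexx orbT.
have hPW (f : 'rV[R]_d -> R) : C1 f -> (\int[rho]_x (`| f x - fine (\int[rho]_z (f z)%:E) |)%:E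
      <= Cpw%:E * \int[rho]_x (enorm (grad f x))%:E)%E.
  move=> /hPW0 h; apply: (le_trans h); apply: lee_wpmul2r.
    by apply: integral_ge0 => x _; rewrite lee_fin sqrtr_ge0.
  by rewrite lee_fin le_max lexx.
have rhoE A : measurable A -> rho A = (fine (rho A))%:E.
  move=> mA; rewrite fineK// ge0_fin_numE//; apply: le_lt_trans (rho_le A mA) _.
  by rewrite rmeasE// -EFinM ltry.
have r_le A : measurable A -> fine (rho A) <= kappa * rmeas mu A.
  by move=> mA; rewrite -lee_fin -rhoE// EFinM -rmeasE//; exact: rho_le.
have le_r A : measurable A -> rmeas mu A <= fine (rho A) + wm / 4.
  by move=> mA; rewrite -lee_fin EFinD -rhoE// -rmeasE//; exact: mu_le.
(* A cell of [gs] has [rho]-mass at least [3 * wm / 4]. With half of it as threshold, either the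
   slab reaches [p], or the cell of [j0] minus the slab does. *)
pose p := 3 * wm / 8.
have p0 : 0 < p by rewrite /p; lra.
pose Q := Cpw * (d%:R * (8 * M%:R ^+ 2 * L)) + 1.
have Q0 : 0 < Q by rewrite ltr_wpDl// !mulr_ge0// exprn_ge0.
(* The first term serves the case of a heavy slab, where [delta <= Bd] turns a constant into a
   multiple of [delta]; the second one is the outcome of [PW]. *)
exists (Num.min (p / (kappa * Bd)) (p / (Q * kappa))).
  by rewrite lt_min !divr_gt0// mulr_gt0.
move=> g S delta i0 j0 d0 dBd i0S j0S gap.
set Sl := slab c y S g gs.
have mSl : measurable Sl by exact: measurable_slab.
pose A1 : set (Rd R d) := \bigcup_(i in [set i | i \in S]) cell c y gs i.
pose A0 : set (Rd R d) := ~` (\bigcup_(i in [set i | i \in S]) cell c y g i).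
have mA1 : measurable A1 by exact: (measurable_cells hcm gs (fun i => i \in S)).
have mA0 : measurable A0 by apply: measurableC; exact: (measurable_cells hcm g (fun i => i \in S)).
have rSl : fine (rho Sl) <= kappa * rmeas mu Sl by exact: r_le.
have [pr|pr] := leP p (fine (rho Sl)).
  apply: (@le_trans _ _ (p / (kappa * Bd) * Bd)).
    by apply: ler_pM => //; [rewrite le_min !divr_ge0 ?mulr_ge0// ltW|exact: ltW|rewrite ge_min lexx].
  rewrite invfM mulrA divfK ?gt_eqF// ler_pdivrMr// mulrC.
  exact: le_trans pr rSl.
(* The sign turns the minimum that defines the cells of [gs] into the maximum used by the
   separator. *)
pose a i x := gs i - ct i x.
have ha i : C1_with setT (a i) (fun k x => 0 - dct i k x).
  apply: C1_withB => //; apply: (C1_with_cst (d := d) (gs i)); exact: openT.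
have cover := Lcell_cover c y i0.
have h1 : (p%:E <= rho A1)%E.
  rewrite rhoE// lee_fin; have := hw i0; have := le_r _ mA1.
  have : rmeas mu (cell c y gs i0) <= rmeas mu A1.
    by apply: rmeas_le => //; [exact: measurable_cell|move=> x hx; exists i0].
  by rewrite /p; move: w0; lra.
have h0 : (p%:E <= rho A0)%E.
  rewrite rhoE// lee_fin.
  have : fine (rho (cell c y gs j0)) <= fine (rho A0) + fine (rho Sl).
    have mc := measurable_cell hcm gs j0.
    rewrite -lee_fin EFinD -!rhoE//.
    apply: le_trans (measureU2 _ mA0 mSl).
    apply: le_measure; rewrite ?inE//; first exact: measurableU.
    move=> x hx; have [t|t] := pselect (A0 x); first by left.
    right; split; first by exists j0.
    exact: contrapT.
  have := hw j0; have := le_r _ (measurable_cell hcm gs j0).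
  by move: w0 pr; rewrite /p; lra.
have := @PW_separation R d M S delta L a _ rho D A1 A0 Sl mD mA1 mA0 mSl rhoD d0 L0 ha.
move=> H; have {H} : (p%:E <= (Cpw * (d%:R * (8 * M%:R ^+ 2 * L / delta)))%:E * rho Sl)%E.
  apply: H => //; last exact: ltW.
  - move=> x i j k Dx; rewrite (_ : _ - _ = dct j k x - dct i k x); first exact: dct_bd.
    by ring.
  - move=> x Dx [i /= iS /LcellP hi]; exists i => // j jS.
    by rewrite /a !ctE//; have := hi j; lra.
  - move=> x Dx nA i iS; have [l hl] := cover g x.
    have lS : l \notin S by apply/negP => lS; apply: nA; exists l.
    exists l => //; rewrite /a !ctE//.
    by have := gap i l iS lS; move/LcellP : hl => /(_ i); lra.
  - move=> x Dx nSl; have [t|t] := pselect (A0 x); first by right.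
    left; have [l hl] := cover gs x.
    have [lS|lS] := boolP (l \in S); first by exists l.
    exfalso; apply: nSl; split; first by exists l.
    exact: contrapT.
rewrite rhoE// -EFinM lee_fin => Hp.
apply: (@le_trans _ _ (p / (Q * kappa) * delta)).
  by apply: ler_wpM2r; [exact: ltW|rewrite ge_min lexx orbT].
rewrite mulrAC ler_pdivrMr ?mulr_gt0//.
have r0 : 0 <= fine (rho Sl) by rewrite fine_ge0.
apply: (@le_trans _ _ (Q * fine (rho Sl))); last first.
  by rewrite [leRHS]mulrC -mulrA ler_pM2l.
rewrite -ler_pdivlMr//; apply: (le_trans Hp).
rewrite (_ : _ * fine _ = (Q - 1) * fine (rho Sl) / delta); last by rewrite /Q; ring.
apply: ler_wpM2r; first by rewrite invr_ge0 ltW.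
by apply: ler_wpM2r => //; lra.
Qed.

(* Pigeonhole: if every one of the [M] slices [(lo + k eta, lo + (k+1) eta]] contained a
   value of [v], then so would the minimal value [lo] itself. *)
Lemma exists_gap (R : realType) (M : nat) (v : 'I_M -> R) (i1 j1 : 'I_M) :
  (forall i, v j1 <= v i) -> (forall i, v i <= v i1) -> v j1 < v i1 ->
  exists S : {set 'I_M}, [/\ i1 \in S, j1 \notin S &
    forall i j, i \in S -> j \notin S -> (v i1 - v j1) / M%:R <= v i - v j].
Proof.
move=> hmin hmax lt; pose eta := (v i1 - v j1) / M%:R.
have M0 : 0 < M%:R :> R by rewrite ltr0n -(card_ord M); apply/card_gt0P; exists i1.
have e0 : 0 < eta by rewrite divr_gt0// subr_gt0.
have [k hk] : exists k : 'I_M, forall j, ~ (v j1 + eta * k%:R < v j <= v j1 + eta * k.+1%:R).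
  apply: contrapT => /forallNP H.
  have /choice[f hf] (k : 'I_M) : exists j, v j1 + eta * k%:R < v j <= v j1 + eta * k.+1%:R.
    by apply: contrapT => /forallNP h; apply: (H k).
  have fI : injective f.
    have lef k l : f k = f l -> (k <= l)%N.
      move=> e; have /andP[h1 _] := hf k; have /andP[_ h2] := hf l.
      rewrite leqNgt; apply/negP => kl; move: h1; rewrite e ltNge => /negP; apply.
      by apply: (le_trans h2); rewrite lerD2l ler_pM2l// ler_nat.
    by move=> k l e; apply/val_inj/eqP; rewrite eqn_leq !lef.
  have /codomP[k ek] : j1 \in codom f by rewrite (inj_card_onto fI).
  have /andP[+ _] := hf k; rewrite -ek ltNge => /negP; apply.
  by rewrite lerDl mulr_ge0// ltW.
exists [set j | v j1 + eta * k%:R < v j]%SET; split.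
- rewrite inE; apply: contrapT => /negP; rewrite -leNgt => h.
  have : v i1 = v j1 + eta * M%:R by rewrite /eta divfK ?gt_eqF//; ring.
  move=> e; move: h; rewrite {1}e lerD2l ler_pM2l// ler_nat leqNgt.
  by rewrite ltn_ord.
- by rewrite inE -leNgt lerDl mulr_ge0// ltW.
- move=> i j; rewrite !inE -leNgt => hi hj; rewrite -/eta.
  have h : v j1 + eta * k.+1%:R < v i.
    by rewrite ltNge; apply/negP => hi2; apply: (hk i); rewrite hi.
  by move: h hj; rewrite -natr1 mulrDr mulr1; lra.
Qed.

Lemma vnorm2_le_osc (R : realType) (M : nat) (v : 'I_M -> R) (e : R) :
  (forall i j, v i - v j <= e) -> vnorm2 v <= M%:R * e ^+ 2.
Proof.
move=> H; rewrite /vnorm2.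
apply: (@le_trans _ _ (\sum_(j < M) e ^+ 2)); last first.
  by rewrite sumr_const card_ord -[leLHS]mulr_natl.
apply: ler_sum => j _.
have e0 : 0 <= e by have := H j j; rewrite subrr.
have M0 : 0 < M%:R :> R by rewrite ltr0n -(card_ord M); apply/card_gt0P; exists j.
rewrite -[leLHS]real_normK ?num_real// lerXn2r ?nnegrE//.
set s := \sum_i v i.
have b (r : R) : M%:R * r = \sum_(i < M) r.
  by rewrite sumr_const card_ord -[RHS]mulr_natl.
have h1 : s <= M%:R * (v j + e).
  by rewrite b; apply: ler_sum => i _; have := H i j; lra.
have h2 : M%:R * (v j - e) <= s.
  by rewrite b; apply: ler_sum => i _; have := H j i; lra.
have h3 : s / M%:R <= v j + e by rewrite ler_pdivrMr// mulrC.
have h4 : v j - e <= s / M%:R by rewrite ler_pdivlMr// mulrC.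
by rewrite ler_norml; apply/andP; split; lra.
Qed.

(** * Optimality and strong monotonicity *)

Section optimality.
Variables (R : realType) (d M : nat) (c : 'rV[R]_d -> 'rV[R]_d -> R) (y : 'I_M -> 'rV[R]_d).
Variables (w : 'I_M -> R) (mu : probability (Rd R d) R) (gs : 'I_M -> R).
Hypothesis hc : forall x z, 0 <= c x z.
Hypothesis hcm : forall j, measurable_fun [set: Rd R d] (fun x : Rd R d => c x (y j)).
Hypothesis hci : forall j, mu.-integrable setT (fun x : Rd R d => (c x (y j))%:E).
Hypothesis tie_null : forall i k (t : R), i != k ->
  mu [set x : Rd R d | c x (y i) - c x (y k) = t] = 0%E.
Hypothesis hw1 : \sum_(i < M) w i = 1.
Hypothesis hgs : forall g, (Hfun c y w mu gs <= Hfun c y w mu g)%E.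
Notation m := (rmeas mu).
Notation cell := (cell c y).

Lemma ctrans_le g i (x : 'rV[R]_d) : ctrans c y g x <= c x (y i) - g i.
Proof. exact: (minI_le (fun i => c x (y i) - g i)). Qed.

Lemma ctrans_attained (i0 : 'I_M) g (x : 'rV[R]_d) : exists i, ctrans c y g x = c x (y i) - g i.
Proof. exact: (minI_attained (fun i => c x (y i) - g i) i0). Qed.

Lemma measurable_ctrans (i0 : 'I_M) g :
  measurable_fun setT ((fun x => ctrans c y g x) : Rd R d -> R).
Proof.
apply: (measurability _ (RGenOInfty.measurableE R)) => // _ [_ [r ->] <-].
rewrite setTI (_ : _ @^-1` _ = \bigcap_(i in [set: 'I_M])
    ((fun x : Rd R d => c x (y i) - g i) @^-1` `]r, +oo[%classic)); last first.
  apply/seteqP; split=> x /=.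
    rewrite in_itv/= andbT => h i _ /=; rewrite in_itv/= andbT.
    exact: lt_le_trans (ctrans_le _ _ _).
  move=> h; have [i e] := ctrans_attained i0 g x.
  by rewrite e; exact: h.
apply: fin_bigcap_measurable => [|i _]; first exact: finite_finset.
rewrite -[X in measurable X]setTI.
have mf : measurable_fun setT (fun x : Rd R d => c x (y i) - g i) by exact: measurable_funB.
by apply: mf => //; exact: measurable_itv.
Qed.

Lemma integrable_hfun (i0 : 'I_M) g : mu.-integrable setT (fun x : Rd R d => (hfun c y w g x)%:E).
Proof.
pose B := \sum_i `|g i|; pose s := \sum_(j < M) w j * g j.
have hB i : `|g i| <= B by rewrite /B (bigD1 i)//= lerDl sumr_ge0.
have hint : mu.-integrable setT (fun x : Rd R d => (c x (y i0) + (B + `|s|))%:E).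
  have := integrableD measurableT (hci i0)
    (finite_measure_integrable_cst mu (B + `|s|) measurableT).
  by apply: eq_integrable => // x _.
apply: le_integrable hint => //.
  apply/measurable_EFinP; rewrite /hfun; apply: measurable_funB => //.
  by apply: measurableT_comp => //; exact: measurable_ctrans i0 g.
move=> x _; rewrite !abse_EFin lee_fin.
have B0 : 0 <= B by rewrite sumr_ge0.
rewrite [leRHS]ger0_norm; last by rewrite !addr_ge0.
rewrite /hfun -/s; apply: (le_trans (ler_normB _ _)).
rewrite normrN addrA lerD2r.
have [i e] := ctrans_attained i0 g x.
have h1 := ctrans_le g i0 x; have h2 := hB i0; have h3 := hB i; have h4 := hc x (y i).
move: h2 h3 h1; rewrite e !ler_norml => /andP[? ?] /andP[? ?] ?.
by have h5 := hc x (y i0); apply/andP; split; lra.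
Qed.

Definition raise_at g j (t : R) : 'I_M -> R := fun i => g i + (if i == j then t else 0).

(** A finite variation replaces the derivative of [H]: raising coordinate [j] by [t] lowers the
    transform by at most [t], and only on the new cell of [j], while the linear term gains
    [t * w j]. Minimality compares the two. *)
Lemma weight_le_raise j (t : R) : 0 < t -> w j <= m (cell (raise_at gs j t) j).
Proof.
move=> t0; set g' := raise_at gs j t; set A := cell g' j.
have mA : measurable A by exact: measurable_cell.
have i1 := integrable_hfun j gs; have i2 := integrable_hfun j g'.
have iA : mu.-integrable setT (fun x : Rd R d => t%:E * (\1_A x)%:E)%E.
  by apply: integrableZl => //; exact: integrable_indic.
have iw : mu.-integrable setT (EFin \o cst (t * w j) : Rd R d -> \bar R).
  exact: finite_measure_integrable_cst.
have pt (x : 'rV[R]_d) : ctrans c y gs x <= ctrans c y g' x + t * \1_A x.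
  rewrite indicE; have [/set_mem hx|/negP hx] := boolP (x \in A).
    have -> : ctrans c y g' x = c x (y j) - g' j by exact: hx.
    by rewrite /g' /raise_at eqxx mulr1; have := ctrans_le gs j x; lra.
  have [k e] := ctrans_attained j g' x.
  rewrite mulr0 addr0 e /g' /raise_at; case: eqP => [kj|_]; last by rewrite addr0 ctrans_le.
  by exfalso; apply: hx; apply/mem_set; rewrite kj in e; exact: e.
have H1 : (\int[mu]_x ((hfun c y w g' x)%:E + (t * w j)%:E) <=
           \int[mu]_x ((hfun c y w gs x)%:E + t%:E * (\1_A x)%:E))%E.
  apply: le_integral; [exact: measurableT|exact: (integrableD measurableT i2 iw)|exact: (integrableD measurableT i1 iA)|].
  move=> x _; rewrite -EFinM -!EFinD lee_fin /hfun.
  have -> : \sum_(k < M) w k * g' k = \sum_(k < M) w k * gs k + t * w j.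
    rewrite /g' /raise_at (eq_bigr (fun k => w k * gs k + (if k == j then t * w k else 0))).
      by rewrite big_split/= -big_mkcond/= big_pred1_eq.
    by move=> k _; case: ifP => _; ring.
  by have := pt x; lra.
rewrite integralD// in H1; rewrite [X in (_ <= X)%E]integralD// in H1.
rewrite integralZl// in H1; last exact: integrable_indic.
have e1 : (\int[mu]_x (\1_A x : R)%:E = (m A)%:E)%E.
  by rewrite integral_indic// setIT; exact: rmeasE.
have e2 : (\int[mu]__ (t * w j)%:E = (t * w j)%:E)%E.
  by rewrite (integral_cst mu measurableT (t * w j)%:E) [X in (_ * X)%E]probability_setT mule1.
rewrite e1 e2 in H1.
have H2 := hgs g'; rewrite /Hfun in H2.
have F2 := integrable_fin_num measurableT i2.
have := le_trans H1 (leeD2r (t%:E * (m A)%:E)%E H2).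
rewrite -(fineK F2) -EFinM -!EFinD lee_fin lerD2l ler_pM2l//.
Qed.

(** The raised cells decrease to a subset of the cell of [gs] as the raise tends to [0], and [mu] is
    continuous from above. *)
Lemma weight_le_cell j : w j <= m (cell gs j).
Proof.
pose F n : set (Rd R d) := cell (raise_at gs j n.+1%:R^-1) j.
have mF n : measurable (F n) by exact: measurable_cell.
have FE u x : cell (raise_at gs j u) j x <->
    forall i, i != j -> c x (y j) - gs j - u <= c x (y i) - gs i.
  split=> [/LcellP h i ij|h].
    by have := h i; rewrite /raise_at eqxx (negbTE ij); lra.
  apply/LcellP => i; rewrite /raise_at eqxx; case: eqP => [->//|/eqP ij].
  by have := h i ij; lra.
have capE : \bigcap_n F n `<=` cell gs j.
  move=> x h; apply/LcellP => i; have [->//|ij] := eqVneq i j.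
  apply/ler_addgt0Pr => e e0.
  have [N _ /(_ N (leqnn N))/= hN] := @near_infty_natSinv_lt R (PosNum e0).
  have /FE/(_ i ij) := h N I; move: hN.
  by move: (N.+1%:R^-1) => u; lra.
have mcap : measurable (\bigcap_n F n) by exact: bigcapT_measurable.
have cvg : mu \o F @ \oo --> mu (\bigcap_n F n).
  apply: nonincreasing_cvg_mu => //; first by rewrite -ge0_fin_numE//; exact: fin_num_measure.
  move=> n k nk; apply/subsetPset => x /FE h; apply/FE => i ij.
  have := h i ij; have : k.+1%:R^-1 <= n.+1%:R^-1 :> R.
    by rewrite lef_pV2 ?posrE// ler_nat.
  by move: (n.+1%:R^-1) (k.+1%:R^-1) => u u'; lra.
apply: (@le_trans _ _ (m (\bigcap_n F n))); last first.
  by apply: rmeas_le => //; exact: measurable_cell.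
rewrite -lee_fin -rmeasE// -(cvg_lim _ cvg)//.
apply: lime_ge; first by apply/cvg_ex; exists (mu (\bigcap_n F n)).
by apply: nearW => n /=; rewrite rmeasE// lee_fin; exact: weight_le_raise.
Qed.

(** Weights and masses both sum to [1], so the one-sided inequalities are equalities. *)
Lemma optimal_cell j : m (cell gs j) = w j.
Proof.
have h0 : \sum_i (m (cell gs i) - w i) = 0.
  by rewrite sumrB hw1 (sum_rmeas_cell hcm tie_null j) subrr.
apply/eqP; rewrite -subr_eq0; apply/eqP; move/psumr_eq0P : h0; apply=> // i _.
by rewrite subr_ge0 weight_le_cell.
Qed.

(** The masses of [K] and of the cell of [j] add up to more than [1], so they share a point. There
    the cell inequality bounds [gs i - gs j] by a difference of costs. *)
Lemma optimal_osc (K : set 'rV[R]_d) (B : R) i j :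
  compact K -> (mu K >= (1 - wmin w / 2)%:E)%E -> (forall i, 0 < w i) ->
  (forall x k, K x -> c x (y k) <= B) -> gs i - gs j <= B.
Proof.
move=> cK hK w0 hB.
have mK : measurable (K : set (Rd R d)).
  by apply: Rd_closed_measurable; exact: compact_closed.
have wj : wmin w <= w j := minI_le w j.
have wm0 : 0 < wmin w by have [k e] := minI_attained w j; rewrite /wmin e; exact: w0.
have mc := measurable_cell hcm gs j.
have [x [Kx cx]] : exists x, K x /\ cell gs j x.
  apply: contrapT => /forallNP h.
  have : mu (K `|` cell gs j) = (mu K + mu (cell gs j))%E.
    by rewrite measureU//; apply/seteqP; split=> // x [Kx cx]; exact: (h x).
  rewrite rmeasE; last exact: measurableU.
  rewrite (rmeasE mu mK) (rmeasE mu mc) -EFinD => -[].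
  have : m (K `|` cell gs j) <= 1.
    by rewrite -(rmeasT mu); apply: rmeas_le => //; exact: measurableU.
  rewrite optimal_cell; move: hK; rewrite (rmeasE mu mK) lee_fin.
  by lra.
have := (LcellP c y gs j x).1 cx i; have := hB x i Kx; have := hc x (y j); lra.
Qed.

End optimality.

Lemma strong_monotonicity (R : realType) (d M : nat)
  (c : 'rV[R]_d -> 'rV[R]_d -> R) (y : 'I_M -> 'rV[R]_d)
  (hcm : forall j, measurable_fun [set: Rd R d] (fun x : Rd R d => c x (y j)))
  (mu : probability (Rd R d) R)
  (tie_null : forall i k (t : R), i != k ->
     mu [set x : Rd R d | c x (y i) - c x (y k) = t] = 0%E) (gs : 'I_M -> R) (i0 : 'I_M)
  (hslab : forall Bd : R, 0 < Bd -> exists2 sigma, 0 < sigma &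
    forall (g : 'I_M -> R) (S : {set 'I_M}) delta i0 j0, 0 < delta -> delta <= Bd ->
      i0 \in S -> j0 \notin S ->
      (forall i j, i \in S -> j \notin S -> delta <= (g i - gs i) - (g j - gs j)) ->
      sigma * delta <= rmeas mu (slab c y S g gs)) (Bd : R) :
  exists2 alpha, 0 < alpha & forall g : 'I_M -> R,
    (forall i j, (g i - gs i) - (g j - gs j) <= Bd) ->
    alpha * vnorm2 (fun j => g j - gs j) <=
    \sum_j (g j - gs j) * (rmeas mu (cell c y g j) - rmeas mu (cell c y gs j)).
Proof.
(* [hslab] asks for a positive bound, and [Bd] may be zero or negative. *)
have B0 : 0 < Num.max Bd 1 by rewrite lt_max ltr01 orbT.
have [sigma s0 H] := hslab _ B0.
have M0 : 0 < M%:R :> R by rewrite ltr0n -(card_ord M); apply/card_gt0P; exists i0.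
(* The gap is the oscillation over [M], and enters squared; the third factor [M] comes from
   [vnorm2_le_osc]. *)
exists (sigma / M%:R ^+ 3); first by rewrite divr_gt0// exprn_gt0.
move=> g hB; pose v j := g j - gs j.
have [j1 e1] := minI_attained v i0.
have [i1 e2] := minI_attained (fun i => - v i) i0.
have hmin i : v j1 <= v i by rewrite -e1; exact: minI_le.
have hmax i : v i <= v i1.
  by have := minI_le (fun i => - v i) i; rewrite e2 lerN2.
have osc : vnorm2 v <= M%:R * (v i1 - v j1) ^+ 2.
  by apply: vnorm2_le_osc => i j; have := hmax i; have := hmin j; lra.
have [le|lt] := leP (v i1) (v j1).
  have : vnorm2 v <= 0.
    by apply: (le_trans osc); rewrite (_ : _ - _ = 0) ?expr0n ?mulr0//; have := hmin i1; lra.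
  move=> h; apply: (@le_trans _ _ 0).
    by rewrite mulr_ge0_le0// divr_ge0// ?exprn_ge0// ltW.
  (* Taking [S] empty and [delta = 0] leaves just the nonnegativity of the sum. *)
  have := @slab_le_monotone R d M c y hcm mu tie_null i0 finset.set0 g gs 0 (lexx 0) _.
  by rewrite mul0r; apply=> i j; rewrite finset.in_set0.
have [S [iS jS gap]] := exists_gap hmin hmax lt.
set delta := (v i1 - v j1) / M%:R in gap.
have d0 : 0 < delta by rewrite divr_gt0// subr_gt0.
have dB : delta <= Num.max Bd 1.
  rewrite le_max /delta ler_pdivrMr//; apply/orP; left.
  apply: (@le_trans _ _ Bd); first exact: hB.
  rewrite ler_peMr//; last by rewrite ler1n -(ltr_nat R).
  by have := hB i1 j1; rewrite -/(v i1) -/(v j1); lra.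
apply: le_trans (slab_le_monotone hcm tie_null i0 (ltW d0) gap).
apply: (@le_trans _ _ (delta * (sigma * delta))); last first.
  by rewrite ler_pM2l//; exact: (H g S delta i1 j1).
apply: (@le_trans _ _ (sigma / M%:R ^+ 3 * (M%:R * (v i1 - v j1) ^+ 2))).
  by rewrite ler_pM2l// divr_gt0// exprn_gt0.
rewrite le_eqVlt; apply/orP; left; apply/eqP; rewrite /delta.
by field; rewrite gt_eqF.
Qed.

(** * Lyapunov function and rate *)

Section lyapunov.
Variables (R : realType) (M : nat) (i0 : 'I_M) (a : R) (gs : 'I_M -> R).
Hypothesis a0 : 0 <= a.
Hypothesis gs_osc : forall i j, gs i - gs j <= a.
Implicit Types (v g : 'I_M -> R).

(** [gs + t] lies in the box exactly for [t] between [shift_lo] and [shift_hi]. *)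
Definition shift_lo : R := - minI (fun j => a + gs j).
Definition shift_hi : R := minI (fun j => a - gs j).
Definition average v : R := (\sum_i v i) / M%:R.
(** The average is the best shift without constraint; clipping it gives the best shift that stays in
    the box. *)
Definition box_shift v : R := Num.max shift_lo (Num.min shift_hi (average v)).

(* Squared Euclidean distance of [gs + v] to the set of the minimizers [gs + t] that lie in the box
   [[-a, a]^M]: the clamp is nonexpansive towards it, which fails for [vnorm2]. *)
Definition lyap v : R := \sum_j (v j - box_shift v) ^+ 2.

Let M0 : 0 < M%:R :> R.
Proof. by rewrite ltr0n -(card_ord M); apply/card_gt0P; exists i0. Qed.

(** Some translate of [gs] fits in the box: its oscillation is at most [a], and the box has width
    [2 * a]. *)
Lemma shift_lo_le_hi : shift_lo <= shift_hi.
Proof.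
rewrite /shift_lo /shift_hi.
have [i ->] := minI_attained (fun j => a + gs j) i0.
have [j ->] := minI_attained (fun j => a - gs j) i0.
by have := gs_osc j i; move: a0 => /=; lra.
Qed.

Lemma shift_itv v : shift_lo <= box_shift v <= shift_hi.
Proof. by rewrite le_max lexx ge_max shift_lo_le_hi ge_min lexx. Qed.

Lemma shift_box t j : shift_lo <= t -> t <= shift_hi -> `|gs j + t| <= a.
Proof.
move=> h1 h2; have := minI_le (fun j => a + gs j) j; have := minI_le (fun j => a - gs j) j.
by rewrite ler_norml /=; move: h1 h2; rewrite /shift_lo /shift_hi => *; apply/andP; split; lra.
Qed.

Lemma sqr_dist_decomp v t :
  \sum_j (v j - t) ^+ 2 = vnorm2 v + M%:R * (average v - t) ^+ 2.
Proof.
have s0 : \sum_j (v j - average v) = 0.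
  by rewrite sumrB sumr_const card_ord -[X in _ - X]mulr_natl /average mulrC divfK ?subrr// gt_eqF.
rewrite /vnorm2 -/(average v).
transitivity (\sum_j ((v j - average v) ^+ 2 + 2 * (average v - t) * (v j - average v) + (average v - t) ^+ 2)).
  by apply: eq_bigr => j _; ring.
by rewrite !big_split/= -mulr_sumr s0 mulr0 addr0 sumr_const card_ord -[X in _ + X]mulr_natl.
Qed.

Lemma lyap_le v t : shift_lo <= t -> t <= shift_hi -> lyap v <= \sum_j (v j - t) ^+ 2.
Proof.
move=> h1 h2; rewrite /lyap !sqr_dist_decomp lerD2l ler_wpM2l//.
rewrite -[leLHS]real_normK ?num_real// -[leRHS]real_normK ?num_real// lerXn2r ?nnegrE//.
have lh := shift_lo_le_hi.
rewrite /box_shift; have [hm|hm] := leP shift_hi (average v).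
  by rewrite (max_idPr lh) !ger0_norm; lra.
have [hl|hl] := leP shift_lo (average v); first by rewrite subrr normr0.
by rewrite !ler0_norm; lra.
Qed.

Lemma vnorm2_le_lyap v : vnorm2 v <= lyap v.
Proof. by rewrite /lyap sqr_dist_decomp lerDl mulr_ge0// sqr_ge0. Qed.

(** Converse comparison, for points of the box only. If the average overshoots [shift_hi], the
    coordinate that defines [shift_hi] lies below it, so the overshoot is at most the deviation of
    that coordinate from the average; likewise at the lower end. *)
Lemma lyap_le_vnorm2 g : (forall j, `|g j| <= a) ->
  lyap (fun j => g j - gs j) <= (1 + M%:R) * vnorm2 (fun j => g j - gs j).
Proof.
move=> hg; set v := fun j => _; rewrite /lyap sqr_dist_decomp mulrDl mul1r lerD2l ler_wpM2l//.
have le_v i t : `|average v - t| <= `|v i - average v| -> (average v - t) ^+ 2 <= vnorm2 v.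
  move=> h; apply: (@le_trans _ _ ((v i - average v) ^+ 2)).
    by rewrite -[leLHS]real_normK ?num_real// -[leRHS]real_normK ?num_real// lerXn2r ?nnegrE.
  by rewrite /vnorm2 (bigD1 i)//= lerDl sumr_ge0// => j _; exact: sqr_ge0.
have lh := shift_lo_le_hi; rewrite /box_shift; have [hm|hm] := leP shift_hi (average v).
  have [i e] := minI_attained (fun j => a - gs j) i0.
  rewrite (max_idPr lh); apply: (le_v i).
  have := hg i; rewrite ler_norml => /andP[_ h].
  have hvi : v i <= shift_hi by rewrite /shift_hi e /v; lra.
  by rewrite ger0_norm ?ler0_norm; lra.
have [hl|hl] := leP shift_lo (average v).
  by rewrite subrr expr0n/= /vnorm2 sumr_ge0// => j _; exact: sqr_ge0.
have [i e] := minI_attained (fun j => a + gs j) i0.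
apply: (le_v i).
have := hg i; rewrite ler_norml => /andP[h _].
have hvi : shift_lo <= v i by rewrite /shift_lo e /v; lra.
by rewrite ler0_norm ?ger0_norm; lra.
Qed.

Lemma clamp_le (t : R) : `|clamp a t| <= a.
Proof.
have h0 := a0; rewrite /clamp ler_norml; have [h|h] := leP a t.
  by rewrite max_r ?lexx ?andbT; lra.
by have [h2|h2] := leP (- a) t; apply/andP; split; lra.
Qed.

Lemma clamp_sqr_dist (t u : R) : `|u| <= a -> (clamp a t - u) ^+ 2 <= (t - u) ^+ 2.
Proof.
have h0 := a0; rewrite ler_norml => /andP[h1 h2].
rewrite -[leLHS]real_normK ?num_real// -[leRHS]real_normK ?num_real// lerXn2r ?nnegrE//.
rewrite /clamp; have [h|h] := leP a t.
  by rewrite max_r ?ger0_norm; lra.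
have [h3|h3] := leP (- a) t; first by [].
by rewrite !ler0_norm; lra.
Qed.

(** By [lyap_le] the shift of the old point may be kept for the new one. With it frozen, the clamp
    shortens each coordinate and the square expands. *)
Lemma lyap_clamp_step g s (gamma : R) :
  lyap (fun j => clamp a (g j - gamma * s j) - gs j) <=
  lyap (fun j => g j - gs j)
  - 2 * gamma * \sum_j s j * (g j - gs j - box_shift (fun j => g j - gs j))
  + gamma ^+ 2 * \sum_j s j ^+ 2.
Proof.
set v := fun j => g j - gs j; have /andP[h1 h2] := shift_itv v.
apply: (le_trans (lyap_le _ h1 h2)).
rewrite /lyap !mulr_sumr -sumrB -big_split/=; apply: ler_sum => j _.
have := clamp_sqr_dist (g j - gamma * s j) (shift_box j h1 h2).
rewrite (_ : clamp a (g j - gamma * s j) - gs j - box_shift v =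
  clamp a (g j - gamma * s j) - (gs j + box_shift v)); last by ring.
move=> h; apply: (le_trans h); rewrite le_eqVlt; apply/orP; left; apply/eqP.
by rewrite /v; ring.
Qed.

End lyapunov.

(** * Rate of the scalar recursion *)

Section rate.
Variable R : realType.

Lemma powR_ge_near (beta c : R) : 0 < beta -> exists N : nat, forall n : nat, (N <= n)%N -> c <= n%:R `^ beta.
Proof.
move=> b0; pose c1 := Num.max c 1.
have c10 : 0 <= c1 by rewrite le_max ler01 orbT.
exists (Num.truncn (c1 `^ beta^-1)).+1 => n hn.
apply: (@le_trans _ _ c1); first by rewrite le_max lexx.
have e : c1 = (c1 `^ beta^-1) `^ beta by rewrite -powRrM mulVf ?lt0r_neq0// powRr1.
rewrite [leLHS]e.
apply: ge0_ler_powR; rewrite ?nnegrE ?powR_ge0//; first exact: ltW.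
by apply: (le_trans (ltW (truncnS_gt _))); rewrite ler_nat.
Qed.

(** Induction on the bound [K / n ^ b]. Passing from [n] to [n + 1] costs a factor at most
    [1 + 1 / n]; since [b < 1], this is eventually at most half of the contraction, and the other
    half absorbs the noise [C]. *)
Lemma rate_recursion (e : nat -> R) (a C b : R) : 0 < a -> 0 <= C -> 0 < b -> b < 1 ->
  (forall n, e n.+1 <= (1 - a / n.+1%:R `^ b) * e n + C / (n.+1%:R `^ b) ^+ 2) ->
  exists (K : R) (N : nat), forall n, (N <= n)%N -> e n <= K / n%:R `^ b.
Proof.
move=> a0 C0 b0 b1 He.
have [N1 H1] := powR_ge_near a b0.
have b1' : 0 < 1 - b by rewrite subr_gt0.
(* The target is half the contraction, [a / 2]; the other factor [2] pays for [n.+1 <= 2 * n]. *)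
have [N2 H2] := powR_ge_near (4 / a) b1'.
pose N := maxn 1 (maxn N1 N2).
(* The first term absorbs the noise, the second one starts the induction at [N]. *)
pose K := Num.max (2 * C / a) (e N * N%:R `^ b).
exists K, N => n; elim: n => [|n IH] hn; first by move: hn; rewrite geq_max.
move: hn; rewrite leq_eqVlt => /orP[/eqP <-|].
  have N0 : 0 < N%:R `^ b by rewrite powR_gt0// ltr0n leq_max.
  by rewrite ler_pdivlMr// le_max lexx orbT.
rewrite ltnS => hn; have {}IH := IH hn.
have n0 : (0 < n)%N by apply: leq_trans hn; rewrite leq_max.
have n0' : 0 < n%:R :> R by rewrite ltr0n.
have pn0 : 0 < n%:R `^ b by rewrite powR_gt0.
have pn1 : 0 < n.+1%:R `^ b by rewrite powR_gt0// ltr0n.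
have hN1 : (N1 <= n.+1)%N by apply/ltnW; rewrite ltnS (leq_trans _ hn)// !leq_max leqnn orbT.
have hN2 : (N2 <= n.+1)%N by apply/ltnW; rewrite ltnS (leq_trans _ hn)// !leq_max leqnn !orbT.
pose q := (n.+1%:R `^ b)^-1.
have q0 : 0 < q by rewrite invr_gt0.
have aq : a * q <= 1 by rewrite ler_pdivrMr// mul1r H1.
have inv_le : (n%:R `^ b)^-1 <= q * (1 + n%:R^-1).
  rewrite /q mulrC ler_pdivlMr// mulrC ler_pdivrMr//.
  have e1 : n.+1%:R = (1 + n%:R^-1) * n%:R :> R.
    by rewrite mulrDl mul1r mulVf ?lt0r_neq0// -natr1 addrC.
  have ge1 : 1 <= 1 + n%:R^-1 :> R by rewrite lerDl invr_ge0 ltW.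
  have r0 := le_trans ler01 ge1.
  rewrite e1 (powRM _ r0 (ltW n0')) ler_pM2r// -[leRHS]powRr1//.
  by apply: ler_powR => //; exact: ltW.
have q_ge : n%:R^-1 <= a / 2 * q.
  have h4 := H2 _ hN2.
  have e2 : n.+1%:R `^ b * n.+1%:R `^ (1 - b) = n.+1%:R :> R.
    by rewrite -powRD ?pnatr_eq0 ?implybT// subrKC powRr1.
  have h5 : n.+1%:R `^ b * (4 / a) <= n.+1%:R by rewrite -[leRHS]e2 ler_pM2l.
  have h6 : n.+1%:R <= 2 * n%:R :> R.
    have : 1 <= n%:R :> R by rewrite ler1n.
    by rewrite -natr1; lra.
  rewrite ler_pdivlMr// mulrC ler_pdivrMr//.
  move: h5; rewrite mulrA ler_pdivrMr// => h5.
  rewrite mulrAC; nra.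
have KC : C <= K * a / 2.
  have : 2 * C / a <= K by rewrite le_max lexx.
  by rewrite ler_pdivrMr//; lra.
have K0 : 0 <= K.
  by apply: (@le_trans _ _ (2 * C / a)); rewrite ?le_max ?lexx// divr_ge0 ?mulr_ge0// ltW.
apply: (le_trans (He n)); rewrite -/q.
have aq1 : 0 <= 1 - a * q by rewrite subr_ge0.
apply: (@le_trans _ _ ((1 - a * q) * (K * (q * (1 + n%:R^-1))) + C * q ^+ 2)).
  rewrite exprVn lerD2r; apply: ler_wpM2l => //.
  by apply: (le_trans IH); apply: ler_wpM2l.
have h : (1 - a * q) * (1 + n%:R^-1) <= 1 - a / 2 * q.
  have : 0 <= a * q * n%:R^-1 by rewrite !mulr_ge0 ?invr_ge0 ?ltW.
  by move: q_ge; move: (n%:R^-1) => u; nra.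
rewrite (_ : _ + _ = K * q * ((1 - a * q) * (1 + n%:R^-1)) + C * q * q); last by ring.
apply: (@le_trans _ _ (K * q * (1 - a / 2 * q) + (K * a / 2) * q * q)).
  apply: lerD; first by apply: ler_wpM2l => //; rewrite mulr_ge0// ltW.
  by rewrite ler_pM2r// ler_pM2r.
by rewrite le_eqVlt; apply/orP; left; apply/eqP; ring.
Qed.

End rate.

(** * The iterates as a function of finitely many patterns *)

Lemma integral_fintype (dsp : measure_display) (T : measurableType dsp) (R : realType)
  (P : probability T R) (I : finType) (f : T -> I) (phi : I -> R) :
  (forall i, measurable (f @^-1` [set i])) -> (forall i, 0 <= phi i) ->
  (\int[P]_x (phi (f x))%:E = (\sum_i phi i * rmeas P (f @^-1` [set i]))%:E)%E.
Proof.
move=> mf phi0.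
have -> : (\int[P]_x (phi (f x))%:E =
    \int[P]_x (\sum_i (phi i)%:E * (\1_(f @^-1` [set i]) x)%:E))%E.
  apply: eq_integral => x _; rewrite (bigD1 (f x))//= big1 ?adde0.
    by rewrite indicE mem_set// mule1.
  by move=> i ix; rewrite indicE memNset ?mule0//= => e; move: ix; rewrite -e eqxx.
have mi i : measurable_fun setT (fun x => (\1_(f @^-1` [set i]) x : R)%:E).
  by apply/measurable_EFinP; exact: measurable_indic.
rewrite ge0_integral_sum//.
- rewrite -sumEFin; apply: eq_bigr => i _.
  have p0 := phi0 i; rewrite ge0_integralZl//.
  by rewrite integral_indic// setIT EFinM; congr (_ * _)%E; exact: rmeasE.
- by move=> i; apply: emeasurable_funM => //; exact: mi.
- by move=> i x _; rewrite mule_ge0// lee_fin.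
Qed.

Section chain.
Variables (R : realType) (d M : nat) (c : 'rV[R]_d -> 'rV[R]_d -> R) (y : 'I_M -> 'rV[R]_d).
Variables (w : 'I_M -> R) (K : set 'rV[R]_d) (gamma1 b : R) (g0 : 'I_M -> R).
Hypothesis hcm : forall j, measurable_fun [set: Rd R d] (fun x : Rd R d => c x (y j)).

(** A set of indices instead of a single one: at a tie several cells contain the sample, and the
    stochastic gradient sees them all. *)
Definition pattern : finType := {ffun 'I_M -> bool}.

Definition pattern_of (g : 'I_M -> R) (x : 'rV[R]_d) : pattern :=
  [ffun j => x \in Lcell c y g j].

Definition psgd_step (k : nat) (g : 'I_M -> R) (s : pattern) : 'I_M -> R :=
  fun j => clamp (csupK c y K) (g j - step gamma1 b k.+1 * ((s j)%:R - w j)).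

(* The most recent pattern comes first. *)
Fixpoint iterate_of (h : seq pattern) : 'I_M -> R :=
  if h is s :: h' then psgd_step (size h') (iterate_of h') s else g0.

(** Where sample [k] must fall for the history to be [h]. The set is deterministic, since the
    iterate it refers to is determined by the older patterns; times beyond the history are
    unconstrained. *)
Fixpoint sample_set (h : seq pattern) (k : nat) : set (Rd R d) :=
  if h is s :: h' then
    (if k == size h' then [set x : 'rV[R]_d | pattern_of (iterate_of h') x = s]
     else sample_set h' k)
  else setT.

Lemma measurable_pattern g s : measurable ([set x : 'rV[R]_d | pattern_of g x = s] : set (Rd R d)).
Proof.
rewrite (_ : [set x : 'rV[R]_d | _] = \bigcap_(j in [set: 'I_M])
   (if s j then cell c y g j else ~` cell c y g j)); last first.
  apply/seteqP; split=> x /=.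
    move=> <- j _; rewrite /pattern_of ffunE; case: ifPn => [/set_mem//|].
    by move=> /negP h hx; apply: h; exact/mem_set.
  move=> h; apply/ffunP => j; rewrite ffunE; have := h j I.
  by case: ifP => _ hx; [exact/mem_set|exact/memNset].
apply: fin_bigcap_measurable => [|j _]; first exact: finite_finset.
by case: ifP => _; [exact: measurable_cell|apply: measurableC; exact: measurable_cell].
Qed.

Lemma measurable_sample_set h k : measurable (sample_set h k).
Proof.
elim: h => //= s h IH; case: ifP => // _; exact: measurable_pattern.
Qed.

Context (d0 : measure_display) (Omega : measurableType d0).
Variables (P : probability Omega R) (X : nat -> Omega -> 'rV[R]_d) (mu : probability (Rd R d) R).
Hypothesis hX : iid_law P X mu.

Fixpoint history (n : nat) (om : Omega) : n.-tuple pattern :=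
  if n is k.+1 then [tuple of pattern_of (iterate_of (history k om)) (X k om) :: history k om]
  else [tuple].

Lemma psgd_history n om :
  psgd c y w K gamma1 b g0 X n om = iterate_of (history n om).
Proof.
elim: n => //= n IH; rewrite IH size_tuple; apply/funext => j.
by rewrite /psgd_step /sgrad indicE ffunE.
Qed.

Lemma history_preimage n (h : n.-tuple pattern) :
  history n @^-1` [set h] = \bigcap_(k in [set k | (k < n)%N]) (X k @^-1` sample_set h k).
Proof.
elim: n h => [|n IH] h.
  rewrite (tuple0 h); apply/seteqP; split=> om /=; first by move=> _ k.
  by move=> _; apply: val_inj.
case/tupleP: h => s h; have sz : size h = n by rewrite size_tuple.
apply/seteqP; split=> om /=.
  move=> /(congr1 val) /= [e1 e2] k /=; rewrite ltnS leq_eqVlt sz.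
  case: eqP => [-> _ /=|_ /= kn].
    by rewrite -e2.
  have : (history n @^-1` [set h]) om by apply: val_inj.
  by rewrite IH => /(_ k); apply.
move=> H.
have e : history n om = h.
  have : (history n @^-1` [set h]) om.
    rewrite IH => k /= kn; have := H k; rewrite /= ltnS (ltnW kn) => /(_ isT).
    by rewrite sz (ltn_eqF kn).
  by [].
apply: val_inj => /=; rewrite e; congr (_ :: _).
by have := H n; rewrite /= ltnS leqnn => /(_ isT); rewrite sz eqxx.
Qed.

Lemma measurable_history n h : measurable (history n @^-1` [set h]).
Proof.
rewrite history_preimage; apply: fin_bigcap_measurable; first exact: finite_II.
move=> k _; rewrite -[X in measurable X]setTI.
by apply: hX.1 => //; exact: measurable_sample_set.
Qed.

(** Plays the part of conditioning on the past: a history is an intersection of events on distinct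
    samples, so its probability is a product whose last factor splits off. *)
Lemma history_independent n (h : n.-tuple pattern) s :
  rmeas P (history n.+1 @^-1` [set [tuple of s :: h]]) =
  rmeas mu [set x : 'rV[R]_d | pattern_of (iterate_of h) x = s] * rmeas P (history n @^-1` [set h]).
Proof.
have [_ [hlaw hind]] := hX.
apply: EFin_inj; rewrite EFinM -!rmeasE; first last.
- exact: measurable_history.
- exact: measurable_pattern.
- exact: measurable_history.
have ltE k : [set i | (i < k)%N] = [set i | i \in iota 0 k].
  by apply/seteqP; split=> i /=; rewrite mem_iota add0n.
rewrite !history_preimage !ltE !hind ?iota_uniq//; try by move=> k; exact: measurable_sample_set.
have sz : size h = n by rewrite size_tuple.
have -> : iota 0 n.+1 = iota 0 n ++ [:: n] by rewrite -addn1 iotaD add0n.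
rewrite big_cat/= big_seq1 sz eqxx hlaw; last exact: measurable_pattern.
rewrite muleC; congr (_ * _)%E.
apply: eq_big_seq => k; rewrite mem_iota add0n leq0n/= => kn.
by rewrite (ltn_eqF kn).
Qed.

Lemma history_sum1 n : \sum_h rmeas P (history n @^-1` [set h]) = 1.
Proof.
rewrite -(rmeasT P) -(@rmeas_disjoint_sum _ _ _ P _ (fun h => history n @^-1` [set h]) xpredT).
- by congr rmeas; apply/seteqP; split=> // om _; exists (history n om).
- exact: measurable_history.
- by move=> h h' om /= -> ->.
Qed.

Definition expect n (phi : ('I_M -> R) -> R) : R :=
  \sum_(h : n.-tuple pattern) phi (iterate_of h) * rmeas P (history n @^-1` [set h]).

Lemma integral_psgd n (phi : ('I_M -> R) -> R) : (forall g, 0 <= phi g) ->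
  (\int[P]_om (phi (psgd c y w K gamma1 b g0 X n om))%:E = (expect n phi)%:E)%E.
Proof.
move=> phi0; under eq_integral do rewrite psgd_history.
rewrite -(@integral_fintype _ _ _ P _ (history n) (fun h => phi (iterate_of h)))//.
exact: measurable_history.
Qed.

(** The tower property, as a finite sum over the past and the next pattern. *)
Lemma expectS n phi : expect n.+1 phi =
  \sum_(h : n.-tuple pattern) rmeas P (history n @^-1` [set h]) *
    \sum_s rmeas mu [set x : 'rV[R]_d | pattern_of (iterate_of h) x = s] *
           phi (psgd_step n (iterate_of h) s).
Proof.
rewrite /expect.
rewrite (reindex (fun p : n.-tuple pattern * pattern => [tuple of p.2 :: p.1])); last first.
  exists (fun t : n.+1.-tuple pattern => ([tuple of behead t], thead t)) => [[h s] _|t _].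
    by rewrite /= theadE; congr (_, _); apply: val_inj.
  by rewrite [RHS]tuple_eta.
transitivity (\sum_(h : n.-tuple pattern) \sum_(s : pattern) phi (iterate_of [tuple of s :: h]) *
   rmeas P (history n.+1 @^-1` [set [tuple of s :: h]])).
  by rewrite pair_bigA.
apply: eq_bigr => h _; rewrite mulr_sumr; apply: eq_bigr => s _.
by rewrite history_independent [iterate_of _]/= size_tuple; ring.
Qed.

Lemma pattern_sum1 g :
  \sum_s rmeas mu [set x : 'rV[R]_d | pattern_of g x = s] = 1.
Proof.
rewrite -(rmeasT mu) -(@rmeas_disjoint_sum _ _ _ mu _
   (fun s => [set x : 'rV[R]_d | pattern_of g x = s] : set (Rd R d)) xpredT).
- by congr rmeas; apply/seteqP; split=> // x _; exists (pattern_of g x).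
- exact: measurable_pattern.
- by move=> s s' x /= -> ->.
Qed.

Lemma pattern_sum_cell g j :
  \sum_s rmeas mu [set x : 'rV[R]_d | pattern_of g x = s] * (s j)%:R = rmeas mu (cell c y g j).
Proof.
transitivity (\sum_(s : pattern | s j) rmeas mu [set x : 'rV[R]_d | pattern_of g x = s]).
  rewrite [RHS]big_mkcond/=; apply: eq_bigr => s _.
  by case: ifP => _; rewrite ?mulr1 ?mulr0.
rewrite -(@rmeas_disjoint_sum _ _ _ mu _
   (fun s => [set x : 'rV[R]_d | pattern_of g x = s] : set (Rd R d)) (fun s : pattern => s j)).
- congr rmeas; apply/seteqP; split=> x /=.
    by move=> [s /= sj e]; move: sj; rewrite -e ffunE => /set_mem.
  by move=> hx; exists (pattern_of g x) => //=; rewrite ffunE; exact/mem_set.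
- exact: measurable_pattern.
- by move=> s s' x /= -> ->.
Qed.

End chain.

(** * Expected descent of the iterates *)

Section convergence.
Variables (R : realType) (d M : nat) (c : 'rV[R]_d -> 'rV[R]_d -> R) (y : 'I_M -> 'rV[R]_d).
Variables (w : 'I_M -> R) (K : set 'rV[R]_d) (gamma1 b : R) (g0 gs : 'I_M -> R) (i0 : 'I_M).
Variable mu : probability (Rd R d) R.
Notation a := (csupK c y K).
Notation m := (rmeas mu).
Hypothesis hw : forall i, 0 < w i.
Hypothesis hw1 : \sum_(i < M) w i = 1.
Hypothesis hcm : forall j, measurable_fun [set: Rd R d] (fun x : Rd R d => c x (y j)).
Hypothesis tie_null : forall i k (t : R), i != k ->
  mu [set x : Rd R d | c x (y i) - c x (y k) = t] = 0%E.
Hypothesis gs_cell : forall j, m (cell c y gs j) = w j.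
Hypothesis a0 : 0 <= a.
Hypothesis gs_osc : forall i j, gs i - gs j <= a.
Hypothesis hg0 : forall j, `|g0 j| <= a.
Hypothesis gamma10 : 0 < gamma1.
Variable alpha : R.
Hypothesis alpha0 : 0 < alpha.
Hypothesis monotone : forall g : 'I_M -> R,
    (forall i j, (g i - gs i) - (g j - gs j) <= 3 * a) ->
    alpha * vnorm2 (fun j => g j - gs j) <=
    \sum_j (g j - gs j) * (m (cell c y g j) - m (cell c y gs j)).

Definition dist_lyap (g : 'I_M -> R) : R := lyap a gs (fun j => g j - gs j).

(** The [2] is that of the expanded square; [1 + M%:R] converts [vnorm2] into the Lyapunov
    function. *)
Let kappa : R := 2 * alpha / (1 + M%:R).

Let M1 : 0 < 1 + M%:R :> R.
Proof. by rewrite ltr_wpDr. Qed.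

Lemma step_ge0 n : 0 <= step gamma1 b n.
Proof. by rewrite divr_ge0 ?powR_ge0// ltW. Qed.

Lemma iterate_box h j : `|iterate_of c y w K gamma1 b g0 h j| <= a.
Proof. by case: h => [|s h]; [exact: hg0|apply: clamp_le]. Qed.

Lemma expected_descent n g : (forall j, `|g j| <= a) ->
  \sum_s m [set x : 'rV[R]_d | pattern_of c y g x = s] * dist_lyap (psgd_step c y w K gamma1 b n g s)
  <= (1 - kappa * step gamma1 b n.+1) * dist_lyap g + M%:R * step gamma1 b n.+1 ^+ 2.
Proof.
move=> hg; pose p s := m [set x : 'rV[R]_d | pattern_of c y g x = s]; set gam := step gamma1 b n.+1.
have gam0 : 0 <= gam by exact: step_ge0.
pose v j := g j - gs j; pose u j := v j - box_shift a gs v.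
have w01 j : 0 <= w j <= 1.
  rewrite ltW//= -hw1 (bigD1 j)//= lerDl sumr_ge0// => i _; exact: ltW.
have bound (s : pattern M) : dist_lyap (psgd_step c y w K gamma1 b n g s) <=
    dist_lyap g - 2 * gam * (\sum_j ((s j)%:R - w j) * u j) + M%:R * gam ^+ 2.
  apply: (le_trans (lyap_clamp_step i0 a0 gs_osc g (fun j => (s j)%:R - w j) gam)).
  rewrite lerD2l mulrC; apply: ler_wpM2r; first exact: sqr_ge0.
  apply: (@le_trans _ _ (\sum_(j < M) 1)); last by rewrite sumr_const card_ord.
  apply: ler_sum => j _; have /andP[w0 w1] := w01 j.
  by case: (s j); rewrite /=; nra.
apply: (@le_trans _ _ (\sum_s p s *
   (dist_lyap g - 2 * gam * (\sum_j ((s j)%:R - w j) * u j) + M%:R * gam ^+ 2))).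
  by apply: ler_sum => s _; apply: ler_wpM2l => //; exact: rmeas_ge0.
have p1 : \sum_s p s = 1 by exact: pattern_sum1.
have -> : \sum_s p s * (dist_lyap g - 2 * gam * (\sum_j ((s j)%:R - w j) * u j) + M%:R * gam ^+ 2) =
    (\sum_s p s) * (dist_lyap g + M%:R * gam ^+ 2)
    - 2 * gam * \sum_s p s * (\sum_j ((s j)%:R - w j) * u j).
  by rewrite mulr_suml mulr_sumr -sumrB; apply: eq_bigr => s _; ring.
have -> : \sum_s p s * (\sum_j ((s j)%:R - w j) * u j) =
    \sum_j (m (cell c y g j) - w j) * u j.
  transitivity (\sum_s \sum_j (p s * (s j)%:R * u j - p s * (w j * u j))).
    by apply: eq_bigr => s _; rewrite mulr_sumr; apply: eq_bigr => j _; ring.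
  rewrite exchange_big/=; apply: eq_bigr => j _.
  by rewrite sumrB -!mulr_suml p1 /p pattern_sum_cell//; ring.
rewrite p1 mul1r.
(* The shift drops out because the mean gradient sums to zero: masses and weights both total [1]. *)
have -> : \sum_j (m (cell c y g j) - w j) * u j =
    \sum_j (g j - gs j) * (m (cell c y g j) - m (cell c y gs j)).
  transitivity (\sum_j ((g j - gs j) * (m (cell c y g j) - m (cell c y gs j))
      - box_shift a gs v * (m (cell c y g j) - w j))).
    by apply: eq_bigr => j _; rewrite gs_cell /u /v; ring.
  by rewrite sumrB -mulr_sumr sumrB hw1 (sum_rmeas_cell hcm tie_null i0) subrr mulr0 subr0.
have mono := monotone (g := g).
(* The [3 * a] of [monotone] is met: two points of the box differ by at most [2 * a] coordinatewise,
   and [gs] oscillates by at most [a]. *)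
have {mono} mono : alpha * vnorm2 v <= \sum_j (g j - gs j) * (m (cell c y g j) - m (cell c y gs j)).
  apply: mono => i j; have := gs_osc j i; have := hg i; have := hg j.
  by rewrite !ler_norml => /andP[? ?] /andP[? ?]; lra.
have lv : dist_lyap g <= (1 + M%:R) * vnorm2 v by exact: lyap_le_vnorm2.
have : kappa * dist_lyap g <= 2 * \sum_j (g j - gs j) * (m (cell c y g j) - m (cell c y gs j)).
  rewrite /kappa -mulrA -mulrA ler_pM2l//.
  apply: le_trans mono; rewrite ler_pM2l// mulrC ler_pdivrMr// mulrC.
  exact: lv.
set Z := \sum_j _ => h.
have : gam * (kappa * dist_lyap g) <= gam * (2 * Z) by apply: ler_wpM2l.
by lra.
Qed.

Context (d0 : measure_display) (Omega : measurableType d0).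
Variables (P : probability Omega R) (X : nat -> Omega -> 'rV[R]_d).
Hypothesis hX : iid_law P X mu.
Hypothesis hb : 0 < b < 1.

Lemma psgd_rate : exists (C : R) (N : nat), forall n : nat, (N <= n)%N ->
  (\int[P]_om (vnorm2 (fun j => psgd c y w K gamma1 b g0 X n om j - gs j))%:E
     <= (C / (n%:R `^ b))%:E)%E.
Proof.
pose e n := expect c y w K gamma1 b g0 P X n dist_lyap.
have kappa0 : 0 < kappa by rewrite divr_gt0// mulr_gt0.
have /andP[b0 b1] := hb.
have rec n : e n.+1 <= (1 - kappa * gamma1 / n.+1%:R `^ b) * e n +
    M%:R * gamma1 ^+ 2 / (n.+1%:R `^ b) ^+ 2.
  rewrite /e (expectS w K gamma1 b g0 hcm hX).
  apply: (@le_trans _ _ (\sum_(h : n.-tuple (pattern M))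
     rmeas P (history c y w K gamma1 b g0 X n @^-1` [set h]) *
     ((1 - kappa * step gamma1 b n.+1) * dist_lyap (iterate_of c y w K gamma1 b g0 h)
       + M%:R * step gamma1 b n.+1 ^+ 2))).
    apply: ler_sum => h _; apply: ler_wpM2l; first exact: rmeas_ge0.
    by apply: expected_descent => j; exact: iterate_box.
  rewrite (eq_bigr (fun h : n.-tuple (pattern M) =>
     (1 - kappa * step gamma1 b n.+1) * (dist_lyap (iterate_of c y w K gamma1 b g0 h) *
     rmeas P (history c y w K gamma1 b g0 X n @^-1` [set h])) +
     rmeas P (history c y w K gamma1 b g0 X n @^-1` [set h]) *
     (M%:R * step gamma1 b n.+1 ^+ 2))); last by move=> h _; ring.
  rewrite big_split/= -mulr_sumr -mulr_suml (history_sum1 w K gamma1 b g0 hcm hX) mul1r.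
  by rewrite /step exprMn exprVn !mulrA.
have := @rate_recursion R e _ _ b (mulr_gt0 kappa0 gamma10) _ b0 b1 rec.
move=> /(_ _)[|C [N H]]; first by rewrite mulr_ge0// sqr_ge0.
exists C, N => n /H hn.
rewrite (integral_psgd w K gamma1 b g0 hcm hX n (phi := fun g => vnorm2 (fun j => g j - gs j))); last first.
  by move=> g; apply: sumr_ge0 => j _; exact: sqr_ge0.
rewrite lee_fin; apply: le_trans hn; apply: ler_sum => h _.
apply: ler_wpM2r; first exact: rmeas_ge0.
exact: vnorm2_le_lyap.
Qed.

End convergence.

(** * The two assumptions *)

Lemma compact_bounded_fun (R : realType) (d : nat) (A : set 'rV[R]_d) (f : 'rV[R]_d -> R) :
  compact A -> (forall x, A x -> {for x, continuous f}) ->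
  exists2 B : R, 0 <= B & forall x, A x -> `|f x| <= B.
Proof.
move=> cA cf.
have cfA : compact (f @` A).
  apply: continuous_compact => //; apply: continuous_in_subspaceT => x /set_mem Ax.
  exact: cf.
have [N [_ HN]] := compact_bounded cfA.
exists (`|N| + 1); first by rewrite addr_ge0.
move=> x Ax; apply: (HN (`|N| + 1)); last by exists x.
by rewrite (le_lt_trans (ler_norm N))// ltrDl.
Qed.

Section support.
Variables (R : realType) (d : nat) (mu : probability (Rd R d) R).

Lemma not_supp (x : 'rV[R]_d) : ~ supp mu x -> exists2 e : R, 0 < e & mu (ball x e) = 0%E.
Proof.
move=> /existsNP[e /not_implyP[e0 /negP h]]; exists e => //.
by apply/eqP; rewrite eq_le measure_ge0 andbT leNgt.
Qed.

Let null_subset (A B : set (Rd R d)) : measurable A -> measurable B -> A `<=` B ->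
  mu B = 0%E -> mu A = 0%E.
Proof.
move=> mA mB AB B0; apply/eqP; rewrite eq_le measure_ge0 andbT -B0.
by apply: le_measure; rewrite ?inE.
Qed.

Lemma measurable_ball_Rd (x : 'rV[R]_d) (e : R) : measurable (ball x e : set (Rd R d)).
Proof. by apply: Rd_open_measurable; exact: ball_open. Qed.

Lemma closed_supp : closed (supp mu).
Proof.
move=> x cx; apply: contrapT => /not_supp[e e0 h].
have [z [hs hz]] := cx _ (nbhsx_ballx x e e0).
have /nbhs_ballP[e' /= e'0 sub] := open_nbhs_nbhs (conj (ball_open x e) hz).
have := hs _ e'0; rewrite lt0e => /andP[/eqP + _]; apply.
exact: (null_subset (measurable_ball_Rd _ _) (measurable_ball_Rd _ _) sub h).
Qed.

Lemma null_not_supp : mu (~` supp mu) = 0%E.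
Proof.
apply: Rd_locally_null.
  by apply: Rd_open_measurable; rewrite openC; exact: closed_supp.
move=> x /not_supp[e e0 h]; exists e => //.
apply: (null_subset _ (measurable_ball_Rd x e) (@subIsetr _ _ _) h).
apply: measurableI; last exact: measurable_ball_Rd.
by apply: Rd_open_measurable; rewrite openC; exact: closed_supp.
Qed.

Lemma compact_supp (r : R) : (forall x, supp mu x -> enorm x <= r) -> compact (supp mu).
Proof.
move=> hr; have cb : compact [set v : 'rV[R]_d | forall i, `[- r, r]%classic (v 0 i)].
  by apply: (@rV_compact _ _ (fun=> `[- r, r]%classic)) => i; exact: segment_compact.
apply: (subclosed_compact closed_supp cb) => x /hr hx i /=.
rewrite in_itv/= -ler_norml; apply: le_trans hx.
rewrite -sqrtr_sqr ler_wsqrtr// (bigD1 i)//= lerDl sumr_ge0// => j _; exact: sqr_ge0.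
Qed.

Variables (lam : {measure set (Rd R d) -> \bar R}) (f : 'rV[R]_d -> R).
Hypotheses (hlam : is_lebesgue lam) (hf : is_density lam mu f).

Lemma density_null (A : set (Rd R d)) : measurable A -> lam A = 0%E -> mu A = 0%E.
Proof.
move=> mA A0; have [_ [mf ->//]] := hf.
apply: null_set_integral => //; apply: measurable_funTS; exact/measurable_EFinP.
Qed.

(** Off the support small balls are null; on it the level set is locally Lebesgue-null, hence null
    by density. [Rd_locally_null] glues the two. *)
Lemma tie_null_of_gradient (g : 'rV[R]_d -> R) (t : R) :
  measurable_fun setT (g : Rd R d -> R) ->
  (forall x, supp mu x -> exists U dg k, [/\ C1_with U g dg, U x & dg k x != 0]) ->
  mu [set x : Rd R d | g x = t] = 0%E.
Proof.
move=> mg hg; have mE : measurable ([set x | g x = t] : set (Rd R d)).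
  by rewrite -[X in measurable X]setTI; exact: (mg measurableT [set t] (measurable_set1 _)).
apply: Rd_locally_null => // x _; have [sx|/not_supp[e e0 h]] := pselect (supp mu x).
  have [U [dg [k [hU Ux dk]]]] := hg x sx.
  have [e e0 h] := lebesgue_level_null hlam hU Ux dk mE (fun z hz => hz).
  exists e => //; apply: density_null => //.
  by apply: measurableI => //; exact: measurable_ball_Rd.
exists e => //; apply: (null_subset _ (measurable_ball_Rd x e) (@subIsetr _ _ _) h).
by apply: measurableI => //; exact: measurable_ball_Rd.
Qed.

End support.

Section assumptions.
Variables (R : realType) (d M : nat) (c : 'rV[R]_d -> 'rV[R]_d -> R) (y : 'I_M -> 'rV[R]_d).
Variables (w : 'I_M -> R) (mu : probability (Rd R d) R) (gs : 'I_M -> R).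
Variables (lam : {measure set (Rd R d) -> \bar R}) (f : 'rV[R]_d -> R).
Hypotheses (hlam : is_lebesgue lam) (hf : is_density lam mu f).
Hypothesis hcm : forall j, measurable_fun [set: Rd R d] (fun x : Rd R d => c x (y j)).

(* What the convergence proof uses of either assumption. *)
Definition regular_cost : Prop :=
  [/\ (forall i k (t : R), i != k -> mu [set x : Rd R d | c x (y i) - c x (y k) = t] = 0%E),
      (forall j, mu.-integrable setT (fun x : Rd R d => (c x (y j))%:E)) &
      exists (rho : {measure set (Rd R d) -> \bar R}) (kappa L : R) (D : set (Rd R d))
        (ct : 'I_M -> 'rV[R]_d -> R) (dct : 'I_M -> 'I_d -> 'rV[R]_d -> R),
      [/\ PW rho /\ 0 < kappa, 0 <= L,
          (forall A, measurable A -> (rho A <= kappa%:E * mu A)%E) /\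
          (forall A, measurable A -> (mu A <= rho A + (wmin w / 4)%:E)%E),
          measurable D /\ rho (~` D) = 0%E &
          [/\ (forall i, C1_with setT (ct i) (dct i)),
              (forall (x : 'rV[R]_d) i, D x -> ct i x = c x (y i)) &
              (forall (x : 'rV[R]_d) i j k, D x -> `|dct i k x - dct j k x| <= L)]]].

(** Here [rho] is [mu] and [D] is its compact support, on which the extended costs agree with the
    given ones and have bounded partial derivatives. *)
Lemma assumptionA_regular : 0 <= wmin w -> assumptionA c y mu -> regular_cost.
Proof.
move=> w0 [[r hr] hPW hC2 hgrad _].
have cS := compact_supp hr.
have mS : measurable (supp mu : set (Rd R d)) by apply: Rd_closed_measurable; exact: closed_supp.
have /choice[U hU] (i : 'I_M) : exists U : set 'rV[R]_d, supp mu `<=` U /\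
    C1_with U (fun x => c x (y i)) (fun k => partial k (fun x => c x (y i))).
  by have [U h1 h2] := C2_set_C1_with (hC2 i); exists U.
split.
- move=> i k t ik.
  apply: (tie_null_of_gradient hlam hf (g := fun x => c x (y i) - c x (y k))).
    by apply: measurable_funB.
  move=> x sx; have gx := hgrad x sx i k ik.
  have [l hl] : exists l, partial l (fun z => c z (y i)) x != partial l (fun z => c z (y k)) x.
    apply: contrapT => /forallNP h; move/eqP: gx; apply; apply/rowP => l; rewrite !mxE.
    by apply/eqP; apply: contrapT => /negP; exact: h.
  have oi := (hU i).2.1; have ok := (hU k).2.1.
  exists (U i `&` U k), (fun l x => partial l (fun x => c x (y i)) x - partial l (fun x => c x (y k)) x), l.
  split; last by rewrite subr_eq0.
    apply: C1_withB; [apply: C1_with_open (hU i).2|apply: C1_with_open (hU k).2].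
    + exact: openI.
    + exact: subIsetl.
    + exact: openI.
    + exact: subIsetr.
  by split; [exact: (hU i).1|exact: (hU k).1].
- move=> j.
  have [B B0 hB] : exists2 B : R, 0 <= B & forall x, supp mu x -> `|c x (y j)| <= B.
    apply: compact_bounded_fun => // x sx.
    by apply: C1_with_continuous (hU j).2 _; exact: (hU j).1.
  apply/integrableP; split; first exact/measurable_EFinP.
  apply: (@le_lt_trans _ _ (\int[mu]_x (B%:E))%E); last first.
    by rewrite (integral_cst mu measurableT B%:E) [X in (_ * X)%E]probability_setT mule1 ltry.
  apply: ae_ge0_le_integral => //.
  - by apply/measurable_EFinP; apply: measurableT_comp.
  - exists (~` supp mu); split; [exact: measurableC|exact: null_not_supp|].
    by move=> x /= h sx; apply: h => _; rewrite lee_fin; exact: hB.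
have /choice[ct hct] (i : 'I_M) : exists ct, exists dct,
    C1_with setT ct dct /\ forall x, supp mu x -> ct x = c x (y i).
  exact: (C1_extension cS (hU i).1 (hU i).2).
have {hct} /choice[dct hct] := hct.
have /choice[B hB] (p : 'I_M * 'I_d) : exists B : R,
    0 <= B /\ forall x, supp mu x -> `|dct p.1 p.2 x| <= B.
  have [|B B0 h] := @compact_bounded_fun R d (supp mu) (dct p.1 p.2) cS; last by exists B.
  by move=> x _; have [_ H] := (hct p.1).1; exact: (H p.2 x I).2.
pose S := \sum_p B p.
have hS p : B p <= S.
  by rewrite /S (bigD1 p)//= lerDl sumr_ge0// => q _; exact: (hB q).1.
have S0 : 0 <= S by rewrite sumr_ge0// => q _; exact: (hB q).1.
exists mu, 1, (2 * S), (supp mu : set (Rd R d)), ct, dct; split=> //.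
- by rewrite mulr_ge0.
- split=> A mA; first by rewrite mul1e.
  by rewrite leeDl// lee_fin divr_ge0.
- by split=> //; exact: null_not_supp.
split.
- by move=> i; exact: (hct i).1.
- by move=> x i; exact: (hct i).2.
- move=> x i j k Dx; apply: (le_trans (ler_normB _ _)).
  have h1 := (hB (i, k)).2 x Dx; have h2 := (hB (j, k)).2 x Dx.
  have h3 := hS (i, k); have h4 := hS (j, k).
  by move: h1 h2; rewrite /=; lra.
Qed.

Lemma C1_with_quadratic (z : 'rV[R]_d) :
  C1_with setT (fun x => enorm (x - z) ^+ 2 / 2) (fun k x => x 0 k - z 0 k).
Proof.
have lin k : C1_with setT (fun x : 'rV[R]_d => x 0 k - z 0 k) (fun i x => (k == i)%:R - 0).
  apply: C1_withB; first by apply: (C1_with_coord k); exact: openT.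
  by apply: (C1_with_cst (d := d) (z 0 k)); exact: openT.
have := @C1_withZ R d setT 2^-1 _ _ (@C1_with_sum R d setT _ (index_enum 'I_d) xpredT _ _ (@openT _)
   (fun k _ => C1_withM (lin k) (lin k))).
congr C1_with.
  apply/funext => x; rewrite mulrC /enorm sqr_sqrtr; last by apply: sumr_ge0 => i _; exact: sqr_ge0.
  by congr (_ * _); apply: eq_bigr => k _; rewrite !mxE expr2.
apply/funext => i; apply/funext => x; rewrite (bigD1 i)//= big1 ?addr0.
  by rewrite eqxx subr0 mulr1; field.
by move=> k /negbTE ->; rewrite subr0 mulr0 addr0.
Qed.

(** The gradient of a quadratic cost is unbounded, but the difference of two of them is a constant
    vector; this is why [regular_cost] bounds only differences, and [D] can be the whole space.
    Normalizing by [s <= 1] only increases [rho], so the lost mass is at most that of the complement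
    of [K']. *)
Lemma assumptionB_regular : injective y -> 0 < wmin w -> wmin w <= 1 ->
  assumptionB c w mu f -> regular_cost.
Proof.
move=> hy w0 w1 [[hc hmom] [K' [mK' [cK' hK' hPW]]] _].
have hC1 i : C1_with setT (fun x => c x (y i)) (fun k x => x 0 k - y i 0 k).
  have := C1_with_quadratic (y i); congr C1_with.
  by apply/funext => x; rewrite hc.
split.
- move=> i k t ik.
  apply: (tie_null_of_gradient hlam hf (g := fun x => c x (y i) - c x (y k))).
    by apply: measurable_funB.
  move=> x _.
  have [l hl] : exists l, y k 0 l != y i 0 l.
    apply: contrapT => /forallNP h; move/eqP: ik; apply; apply: hy; apply/rowP => l.
    by apply/esym/eqP; apply: contrapT => /negP; exact: h.
  exists setT, (fun l x => (x 0 l - y i 0 l) - (x 0 l - y k 0 l)), l; split=> //.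
    exact: C1_withB.
  rewrite (_ : _ - _ = y k 0 l - y i 0 l); last by ring.
  by rewrite subr_eq0.
- move=> j.
  have mE : measurable_fun setT ((fun x : 'rV[R]_d => enorm x ^+ 2) : Rd R d -> R).
    apply: measurable_funX; apply: (@measurable_enorm R d id) => k.
    by apply: Rd_continuous_measurable => x; exact: coord_continuous.
  have iE : mu.-integrable setT (fun x : Rd R d => (enorm x ^+ 2)%:E).
    apply/integrableP; split; first exact/measurable_EFinP.
    rewrite (eq_integral (fun x : Rd R d => (enorm x ^+ 2)%:E))// => x _.
    by rewrite gee0_abs// lee_fin sqr_ge0.
  have := integrableD measurableT iE
    (finite_measure_integrable_cst mu (enorm (y j) ^+ 2) measurableT).
  apply: le_integrable => //; first exact/measurable_EFinP.
  move=> x _; rewrite /= lee_fin hc.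
  rewrite !ger0_norm ?addr_ge0 ?divr_ge0 ?sqr_ge0//.
  rewrite ler_pdivrMr// /enorm !sqr_sqrtr; try by apply: sumr_ge0 => i _; exact: sqr_ge0.
  rewrite -big_split/= mulr_suml; apply: ler_sum => i _; rewrite !mxE.
  by have := sqr_ge0 (x 0 i + y j 0 i); nra.
have mT : mu K' = (rmeas mu K')%:E by exact: rmeasE.
set s := rmeas mu K' in mT.
have s1 : s <= 1 by rewrite -(rmeasT mu); apply: rmeas_le.
have s2 : 1 - wmin w / 4 <= s by move: hK'; rewrite mT lee_fin.
have s0 : 0 < s by lra.
pose rho : {measure set (Rd R d) -> \bar R} := mnormalize (mrestr mu mK') mu.
have rhoE A : rho A = (mu (A `&` K') * s^-1%:E)%E.
  have eT : mrestr mu mK' setT = s%:E by rewrite /mrestr setTI.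
  (* [mnormalize] falls back on [mu] when the total mass is zero or infinite; [0 < s] and finiteness
     exclude this. *)
  have -> : rho A = (if (mrestr mu mK' setT == 0) || (mrestr mu mK' setT == +oo)
      then fun U : set (Rd R d) => mu U
      else fun U => mrestr mu mK' U * (fine (mrestr mu mK' setT))^-1%:E)%E A by [].
  by rewrite eT eqe (gt_eqF s0).
pose L := \sum_(p : 'I_M * 'I_d) `|y p.1 0 p.2|.
have hL i k : `|y i 0 k| <= L.
  by rewrite /L (bigD1 (i, k))//= lerDl sumr_ge0.
exists rho, s^-1, (2 * L), setT, (fun i x => c x (y i)), (fun i k x => x 0 k - y i 0 k); split.
- by rewrite invr_gt0.
- by rewrite mulr_ge0// sumr_ge0.
- split=> A mA; rewrite rhoE.
    rewrite muleC; apply: lee_wpmul2l; first by rewrite lee_fin invr_ge0 ltW.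
    by apply: le_measure; rewrite ?inE//; exact: measurableI.
  have mAK : measurable (A `&` K') by exact: measurableI.
  have mC : measurable (~` K') by exact: measurableC.
  have h1 : rmeas mu A <= rmeas mu (A `&` K') + rmeas mu (~` K').
    apply: le_trans (rmeasU_le _ mAK mC); apply: rmeas_le => //; first exact: measurableU.
    by move=> x Ax; have [k|k] := pselect (K' x); [left|right].
  have h2 : rmeas mu (~` K') = 1 - s.
    apply: EFin_inj; rewrite -rmeasE// probability_setC// mT.
    by rewrite EFinB.
  have h3 : rmeas mu (A `&` K') <= rmeas mu (A `&` K') * s^-1.
    by rewrite ler_peMr ?rmeas_ge0// invf_ge1.
  rewrite (rmeasE mu mA) (rmeasE mu mAK) -EFinM -EFinD lee_fin.
  by lra.
- by split=> //; rewrite setCT measure0.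
split=> // x i j k _.
rewrite [X in `|X|](_ : _ = y j 0 k - y i 0 k); last by ring.
apply: (le_trans (ler_normB _ _)); have := hL i k; have := hL j k; lra.
Qed.

End assumptions.

Theorem theorem4p4
  (R : realType) (d M : nat)
  (* target measure nu = sum_i w_i delta_{y_i} *)
  (y : 'I_M -> 'rV[R]_d) (w : 'I_M -> R)
  (hy : injective y) (hw : forall i, 0 < w i) (hw1 : \sum_(i < M) w i = 1)
  (* cost *)
  (c : 'rV[R]_d -> 'rV[R]_d -> R) (hc : forall x z, 0 <= c x z)
  (hcm : forall j, measurable_fun [set: Rd R d] (fun x : Rd R d => c x (y j)))
  (* source measure mu, absolutely continuous with density f_mu *)
  (lam : {measure set (Rd R d) -> \bar R}) (hlam : is_lebesgue lam)
  (mu : probability (Rd R d) R) (fmu : 'rV[R]_d -> R)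
  (hf : is_density lam mu fmu)
  (hAB : assumptionA c y mu \/ assumptionB c w mu fmu)
  (* a minimizer g* of H *)
  (gstar : 'I_M -> R) (hgstar : forall g, (Hfun c y w mu gstar <= Hfun c y w mu g)%E)
  (* PSGD data *)
  (K : set 'rV[R]_d) (hK : compact K)
  (hmuK : (mu K >= (1 - wmin w / 2)%:E)%E)
  (hcK : exists B : R, forall x j, K x -> `| c x (y j) | <= B)
  (g0 : 'I_M -> R) (hg0 : forall j, `| g0 j | <= csupK c y K)
  (gamma1 b : R) (hgamma1 : 0 < gamma1) (hb : 1 / 2 < b < 1)
  (d0 : measure_display) (Omega : measurableType d0) (P : probability Omega R)
  (X : nat -> Omega -> 'rV[R]_d) (hX : iid_law P X mu) :
  exists (C : R) (N : nat), forall n : nat, (N <= n)%N ->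
    (\int[P]_om (vnorm2 (fun j => psgd c y w K gamma1 b g0 X n om j
                                  - gstar j))%:E
       <= (C / (n%:R `^ b))%:E)%E.
Proof.
have [i0 _] : exists i : 'I_M, True.
  apply: contrapT => /forallNP h; move: hw1; rewrite big1 => [/eqP|i _].
    by rewrite eq_sym oner_eq0.
  by exfalso; exact: (h i).
have wm0 : 0 < wmin w by have [k e] := minI_attained w i0; rewrite /wmin e; exact: hw.
have wm1 : wmin w <= 1.
  apply: (le_trans (minI_le w i0)); rewrite -hw1 (bigD1 i0)//= lerDl sumr_ge0// => i _.
  exact: ltW.
have : regular_cost c y w mu.
  case: hAB => [hA|hB]; first by apply: (assumptionA_regular hlam hf) => //; exact: ltW.
  exact: (assumptionB_regular hlam hf hcm hy wm0 wm1 hB).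
move=> [tie hci [rho [kappa [L [D [ct [dct [[hPW k0] L0 [rle mle] [mD rD] [hct ctE dbd]]]]]]]]].
(* A point of [K] is needed for the supremum of the costs to be nonnegative; an empty [K] would
   contradict [wmin w <= 1]. *)
have [x0 Kx0] : exists x, K x.
  apply: contrapT => /forallNP h.
  have K0 : K = set0 by apply/seteqP; split=> x // Kx; exact: (h x).
  by move: hmuK; rewrite K0 measure0 lee_fin; lra.
have csup x k : K x -> c x (y k) <= csupK c y K.
  move=> Kx; rewrite -[leLHS]ger0_norm//; apply: sup_upper_bound; last by exists x, k.
  split; first by exists `|c x (y k)|, x, k.
  by have [B hB] := hcK; exists B => r [z [j [Kz ->]]]; exact: hB.
have a0 : 0 <= csupK c y K by apply: le_trans (csup x0 i0 Kx0).
have gs_cell := optimal_cell hc hcm hci tie hw1 hgstar.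
have gs_osc i j : gstar i - gstar j <= csupK c y K.
  exact: (optimal_osc hc hcm hci tie hw1 hgstar i j hK hmuK hw csup).
have wm_cell j : wmin w <= rmeas mu (cell c y gstar j) by rewrite gs_cell minI_le.
have slab_ge := slab_lower_bound hcm hPW k0 wm0 L0 rle mle mD rD hct ctE dbd wm_cell.
have [alpha alpha0 mono] := strong_monotonicity hcm tie i0 slab_ge (3 * csupK c y K).
have b01 : 0 < b < 1.
  by move: hb => /andP[b1 ->]; rewrite andbT (lt_trans _ b1)// divr_gt0.
exact: (psgd_rate i0 hw hw1 hcm tie gs_cell a0 gs_osc hg0 hgamma1 alpha0 mono hX b01).
Qed.
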